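(* There is an absolute constant $c$ such that every $d$-degenerate graph $H$ on $k$ vertices with chromatic number $\chi \geq 2$ has induced Ramsey number $r_{\mathrm{ind}}(H) \leq k^{cd \log \chi}$.
   Context: All graphs are finite and simple; $\log$ is to base $2$. A graph is $d$-degenerate if every subgraph of it has a vertex of degree at most $d$. The induced Ramsey number $r_{\mathrm{ind}}(H)$ is the minimum $n$ for which there is a graph $G$ with $n$ vertices such that for every $2$-edge-coloring of $G$ there is an induced subgraph of $G$ isomorphic to $H$ all of whose edges have the same color. *)

(* Defs.v *)
From HB Require Import structures.
From mathcomp Require Import all_boot all_order all_algebra.
From mathcomp Require Import reals exp.

Set Implicit Arguments.
Unset Strict Implicit.
Unset Printing Implicit Defensive.

Record sgraph := SGraph {
  vertex :> finType;
  edge : rel vertex;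
  edge_sym : symmetric edge;
  edge_irr : irreflexive edge }.

Definition iso (G H : sgraph) : Prop :=
  exists2 f : G -> H, bijective f & forall x y, edge (f x) (f y) = edge x y.

Section Subgraphs.
Variable G : sgraph.

(* The subgraph with vertex set S and adjacency relation e; it need not be
   induced. *)
Definition is_subgraph (S : {set G}) (e : rel G) : Prop :=
  symmetric e /\ forall x y, e x y -> [/\ x \in S, y \in S & edge x y].

(* The graph without vertices is not counted as a subgraph here, since it has
   no vertex of any degree. *)
Definition degenerate (d : nat) : Prop :=
  forall (S : {set G}) (e : rel G), is_subgraph S e -> S != set0 ->
    exists2 x, x \in S & #|[set y in S | e x y]| <= d.

Definition induced_edge (S : {set G}) : rel {x : G | x \in S} :=
  fun x y => edge (val x) (val y).

Lemma induced_edge_sym S : symmetric (@induced_edge S).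
Proof. by move=> x y; apply: edge_sym. Qed.

Lemma induced_edge_irr S : irreflexive (@induced_edge S).
Proof. by move=> x; apply: edge_irr. Qed.

Definition induced (S : {set G}) : sgraph :=
  SGraph (@induced_edge_sym S) (@induced_edge_irr S).

Definition colorable (q : nat) : bool :=
  [exists f : {ffun G -> 'I_q}, forall x, forall y, edge x y ==> (f x != f y)].

Lemma ex_colorable : exists q, colorable q.
Proof.
exists #|G|; apply/existsP; exists [ffun x => enum_rank x].
apply/forallP => x; apply/forallP => y; apply/implyP => exy.
rewrite !ffunE (inj_eq enum_rank_inj); apply: contraTneq exy => ->.
by rewrite edge_irr.
Qed.

Definition chromatic_number : nat := ex_minn ex_colorable.

(* A 2-edge-coloring is given by a map col : {set G} -> bool, the color of the
   edge xy being col [set x; y]; the values of col on sets that are not edges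
   play no role. *)
Definition monochromatic (col : {set G} -> bool) (S : {set G}) : Prop :=
  exists b : bool, forall x y, x \in S -> y \in S -> edge x y ->
    col [set x; y] = b.

Definition induced_arrow (H : sgraph) : Prop :=
  forall col : {set G} -> bool,
    exists2 S : {set G}, iso (induced S) H & monochromatic col S.

End Subgraphs.

Definition has_induced_ramsey_graph (H : sgraph) (n : nat) : Prop :=
  exists2 G : sgraph, #|G| = n & induced_arrow G H.

(* r_ind(H) = n *)
Definition is_induced_ramsey_number (H : sgraph) (n : nat) : Prop :=
  has_induced_ramsey_graph H n /\
  forall m, has_induced_ramsey_graph H m -> n <= m.

Definition log2 (R : realType) (x : R) : R := (ln x / ln 2)%R.

(* Main.v *)
Require Import Defs.
From HB Require Import structures.
From mathcomp Require Import all_boot all_order all_algebra finfield.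
From mathcomp Require Import ring lra zify.
From mathcomp Require Import boolp reals exp.

(** Let H be d-degenerate on k vertices with chromatic number chi, and let
    h = ceil(log chi).  The host graph G has n vertices, edge density
    p = 1/O(k), and is pseudo-random: for every vertex set B, the deviations of
    the degrees into B from p|B| sum to at most 2 n^(7/4) ([jumbled]).  It is
    the explicit graph on pairs over a finite field in which (a, a') and
    (b, b') are joined when ab + a' + b' falls in a fixed set; a second moment
    computation gives the deviation ([affine_graph_jumbled]).  Since n is
    k^O(dh), sets of size n k^-O(dh) still look random.

    Colour the edges of G.  Call two sets a sparse pair if at most a proportion
    eps = k^-O(1) of the pairs between them are red, and let delta = k^-O(d).

    Suppose first that some large set U contains no sparse pair of subsets of
    size delta |U|.  Then H embeds in red inside U, one vertex at a time in a
    degeneracy order, with a set C u of candidates kept for each unplaced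
    vertex u ([dense_embedding]).  Placing v at x restricts C u to the red
    neighbours of x if uv is an edge, and to the non-neighbours of x otherwise.
    The first happens at most d times for each u and costs a factor eps, as
    few x have a smaller red degree into C u; the second costs only a factor
    1 - O(1/k), because the density of G is O(1/k).  So the candidate sets
    never get smaller than eps^d |U| / 2, and the absence of sparse pairs can
    be used to the end.

    Otherwise every large set contains a sparse pair.  Iterating h times, at
    the price of a factor delta/2 in size each time, yields 2^h sets W_i with
    pairwise red density at most 2^(h+1) eps ([sparse_family]).  Now H embeds
    in blue, with the i-th colour class of a proper colouring inside W_i
    ([sparse_embedding]).  The candidate sets shrink by factors p^d, well below
    the scale at which a density bound on the W_i says anything about them, so
    the red density has to be controlled along the way.  The potential is the
    sum of the red densities between C u and C w over all edges uw of H not yet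
    embedded.  By pseudo-randomness, restricting C u and C w to the
    neighbourhood of a random x preserves the expected density, so that some x
    lets the potential grow by a factor of at most 1 + O(1/k).  Over k steps
    the potential stays bounded, hence blue degrees stay close to p|C u|.

    The constraint on n comes from the second case: sets of size
    n (delta/2)^h eps^d = n k^-O(dh) must look random, which is why the
    exponent is of order d log chi. *)

Set Implicit Arguments.
Unset Strict Implicit.
Unset Printing Implicit Defensive.

Import Order.TTheory GRing.Theory Num.Theory.
Local Open Scope ring_scope.

(** * Degrees and numbers of pairs in a pseudo-random relation *)

Lemma eq_ler (R : numDomainType) (x y : R) : x = y -> x <= y.
Proof. by move=> ->. Qed.

Section Counting.
Variables (R : realFieldType) (V : finType).
Implicit Types (r : rel V) (x y z : V) (A B X Y Z : {set V}).

Definition deg r x B : R := \sum_(y in B) (r x y)%:R.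
Definition npairs r A B : R := \sum_(x in A) deg r x B.
(** An L1 form of pseudo-randomness.  It bounds at once the number of vertices
    of unusual degree into B and any weighted sum of degrees into B. *)
Definition jumbled r (p Xi : R) : Prop :=
  forall B, \sum_y `|deg r y B - p * #|B|%:R| <= Xi.

Lemma degE r x B : deg r x B = #|[set y in B | r x y]|%:R.
Proof.
rewrite /deg -sum1_card natr_sum big_mkcond [RHS]big_mkcond /=.
by apply: eq_bigr => y _; rewrite inE; case: (y \in B); case: (r x y).
Qed.

Lemma deg_ge0 r x B : 0 <= deg r x B.
Proof. by rewrite degE ler0n. Qed.

Lemma deg_le r x B : deg r x B <= #|B|%:R.
Proof.
by rewrite degE ler_nat subset_leq_card //; apply/subsetP => y; rewrite inE => /andP[].
Qed.

Lemma npairs_ge0 r A B : 0 <= npairs r A B.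
Proof. by apply: sumr_ge0 => x _; apply: deg_ge0. Qed.

Lemma npairs_sym r A B : symmetric r -> npairs r A B = npairs r B A.
Proof.
move=> sr; rewrite /npairs /deg exchange_big /=.
by apply: eq_bigr => x _; apply: eq_bigr => y _; rewrite sr.
Qed.

Lemma markov_card (F : V -> R) A (t : R) : 0 <= t -> (forall x, 0 <= F x) ->
  #|[set x in A | t < F x]|%:R * t <= \sum_(x in A) F x.
Proof.
move=> t0 F0; rewrite mulr_natl -sumr_const.
rewrite big_mkcond [leRHS]big_mkcond; apply: ler_sum => x _.
rewrite inE; case: (x \in A) => //=; case: ifP => // h; first exact: ltW.
Qed.

Lemma union_card (I : Type) (s : seq I) (P : I -> V -> bool) A :
  (#|[set x in A | has (P^~ x) s]| <= \sum_(i <- s) #|[set x in A | P i x]|)%N.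
Proof.
elim: s => [|i s IH].
  by rewrite big_nil leqn0 cards_eq0; apply/eqP/setP => x; rewrite !inE andbF.
rewrite big_cons; apply: leq_trans (leq_add (leqnn _) IH).
apply: leq_trans (leq_card_setU _ _); apply: subset_leq_card.
by apply/subsetP => x; rewrite !inE /=; case: (x \in A).
Qed.

Lemma exists_le_average (F : V -> R) A (c : R) : (0 < #|A|)%N ->
  \sum_(x in A) F x <= #|A|%:R * c -> exists2 x, x \in A & F x <= c.
Proof.
move=> A0 le; case: (boolP [exists x in A, F x <= c]) => [/exists_inP //|].
rewrite negb_exists_in => /forall_inP h; suff : #|A|%:R * c < \sum_(x in A) F x.
  by rewrite ltNge le.
rewrite mulr_natl -sumr_const; apply: ltr_sum => [|x xA].
  by case/card_gt0P: A0 => x xA; apply/hasP; exists x; rewrite ?mem_index_enum.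
by rewrite ltNge h.
Qed.

Variables (e : rel V) (p Xi : R).
Hypotheses (e_sym : symmetric e) (jum : jumbled e p Xi) (p_ge0 : 0 <= p).

Lemma Xi_ge0 : 0 <= Xi.
Proof. by apply: le_trans (jum set0); apply: sumr_ge0 => y _. Qed.

(** Degrees into X can be replaced by their expected value p|X| inside a sum
    with bounded weights, at the cost of the total deviation. *)
Lemma weighted_deg_le (w : V -> R) (c : R) Y X :
  (forall y, y \in Y -> 0 <= w y <= c) -> 0 <= c ->
  \sum_(y in Y) w y * deg e y X <= p * #|X|%:R * (\sum_(y in Y) w y) + c * Xi.
Proof.
move=> hw c0.
have -> : \sum_(y in Y) w y * deg e y X
   = p * #|X|%:R * (\sum_(y in Y) w y) + \sum_(y in Y) w y * (deg e y X - p * #|X|%:R).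
  rewrite mulr_sumr -big_split /=; apply: eq_bigr => y _; ring.
rewrite lerD2l; apply: le_trans (_ : c * \sum_(y in Y) `|deg e y X - p * #|X|%:R| <= _).
  rewrite mulr_sumr; apply: ler_sum => y /hw /andP[w0 wc].
  apply: le_trans (ler_norm _) _; rewrite normrM ger0_norm //.
  by apply: ler_wpM2r.
apply: ler_wpM2l => //; apply: le_trans (jum X).
rewrite big_mkcond; apply: ler_sum => y _; by case: ifP.
Qed.

(** Summed over x, the r-pairs between the neighbourhood of x in Y and Z weight
    each y in Y by its r-degree into Z times its degree into X. *)
Lemma sum_restrict1 r X Y Z :
  \sum_(x in X) \sum_(y in Y) \sum_(z in Z) (r y z && e x y)%:R
    <= p * #|X|%:R * npairs r Y Z + #|Z|%:R * Xi.
Proof.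
rewrite /npairs; have h := @weighted_deg_le (fun y => deg r y Z) #|Z|%:R Y X.
apply: le_trans (h _ (ler0n _ _)); last by move=> y _; rewrite deg_ge0 deg_le.
rewrite exchange_big /=; apply: ler_sum => y _.
rewrite mulrC /deg mulr_suml; apply: ler_sum => x _.
rewrite mulr_sumr; apply: ler_sum => z _.
by rewrite (e_sym x); case: (r y z); case: (e y x); rewrite ?mulr0 ?mulr1.
Qed.

(** Here the pair (y, z) is counted once for each common neighbour in X.  For
    fixed z these lie in the set X' of neighbours of z in X, so jumbledness is
    applied first to X', and then to X itself to estimate |X'|. *)
Lemma sum_restrict2 r X Y Z :
  \sum_(x in X) \sum_(y in Y) \sum_(z in Z) [&& r y z, e x y & e x z]%:R
    <= p ^+ 2 * #|X|%:R * npairs r Y Z + (p * #|Y|%:R + #|Z|%:R) * Xi.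
Proof.
pose rT : rel V := fun z y => r y z.
have -> : npairs r Y Z = npairs rT Z Y by rewrite /npairs /deg exchange_big.
have step z : z \in Z ->
  \sum_(x in X) \sum_(y in Y) [&& r y z, e x y & e x z]%:R
   <= p * deg e z X * deg rT z Y + Xi.
  move=> _; pose X' := [set x in X | e z x].
  have -> : deg e z X = #|X'|%:R by rewrite degE.
  have h := @weighted_deg_le (fun y => (r y z)%:R) 1 Y X'.
  rewrite -[Xi]mul1r; apply: le_trans (h _ ler01); last first.
    by move=> y _; case: (r y z); rewrite ?lexx ?ler01.
  rewrite exchange_big; apply: ler_sum => y _; rewrite /deg mulr_sumr.
  rewrite big_mkcond [leRHS]big_mkcond; apply: ler_sum => x _; rewrite !inE.
  rewrite (e_sym x y) (e_sym x z).
  by case: (x \in X); case: (r y z); case: (e y x); case: (e z x); rewrite ?mulr0 ?mulr1 ?mul0r.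
have -> : \sum_(x in X) \sum_(y in Y) \sum_(z in Z) [&& r y z, e x y & e x z]%:R =
   \sum_(z in Z) \sum_(x in X) \sum_(y in Y) [&& r y z, e x y & e x z]%:R :> R.
  by rewrite [RHS]exchange_big /=; apply: eq_bigr => x _; rewrite exchange_big.
apply: le_trans (ler_sum _ step) _; rewrite big_split /= sumr_const.
have -> : \sum_(z in Z) p * deg e z X * deg rT z Y = p * \sum_(z in Z) deg rT z Y * deg e z X.
  by rewrite mulr_sumr; apply: eq_bigr => z _; ring.
have := @weighted_deg_le (fun z => deg rT z Y) #|Y|%:R Z X.
move=> /(_ _ (ler0n _ _)) h.
have {}h := ler_wpM2l p_ge0 (h _).
have -> : Xi *+ #|Z| = #|Z|%:R * Xi by rewrite mulr_natl.
rewrite /npairs.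
apply: le_trans (lerD (h _) (lexx _)) _; first by move=> z _; rewrite deg_ge0 deg_le.
lra.
Qed.
(** The four ways in which the candidate sets Y and Z of two vertices of H are
    affected when a third vertex is placed at x, averaged over x in X. *)
Lemma sum_restrict (bu bw : bool) r X Y Z : p <= 1 ->
  \sum_(x in X) \sum_(y in Y) \sum_(z in Z)
     [&& r y z, bu ==> e x y & bw ==> e x z]%:R
  <= #|X|%:R * (if bu then p else 1) * (if bw then p else 1) * npairs r Y Z
     + (#|Y|%:R + #|Z|%:R) * Xi.
Proof.
move=> p1; have X0 := Xi_ge0.
have Y0 : 0 <= #|Y|%:R * Xi by rewrite mulr_ge0.
have Z0 : 0 <= #|Z|%:R * Xi by rewrite mulr_ge0.
case: bu; case: bw => /=.
- apply: le_trans (sum_restrict2 r X Y Z) _.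
  have : p * (#|Y|%:R * Xi) <= #|Y|%:R * Xi by rewrite ler_piMl.
  lra.
- under eq_bigr do under eq_bigr do under eq_bigr do rewrite andbT.
  apply: le_trans (sum_restrict1 r X Y Z) _; lra.
- pose rT : rel V := fun z y => r y z.
  have -> : npairs r Y Z = npairs rT Z Y by rewrite /npairs /deg exchange_big.
  under eq_bigr do rewrite exchange_big /=.
  apply: le_trans (sum_restrict1 rT X Z Y) _; lra.
- under eq_bigr do under eq_bigr do under eq_bigr do rewrite andbT.
  rewrite sumr_const -mulr_natl -/(deg _ _ _) /npairs /deg; lra.
Qed.
End Counting.

(** * Embedding one vertex at a time *)

Section Greedy.
Variables (H G : sgraph) (mono : rel G).
Implicit Types (C : H -> {set G}) (s : seq H).

(** The candidates for u that remain once v has been placed at x.  Excluding x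
    itself in the second case makes the embedding injective. *)
Definition shrink (v : H) (x : G) C (u : H) : {set G} :=
  if edge v u then [set y in C u | mono x y]
  else [set y in C u | ~~ edge x y & y != x].

(** The invariant speaks of the list of vertices still to be placed and of
    their candidate sets; x0 only serves as a value outside the list. *)
Lemma greedy_embedding (x0 : G) (Inv : seq H -> (H -> {set G}) -> Prop) :
  symmetric mono ->
  (forall v s C, v \notin s -> Inv (v :: s) C ->
     exists2 x, x \in C v & Inv s (shrink v x C)) ->
  forall s C, uniq s -> Inv s C ->
  exists2 f : H -> G, {in s, forall u, f u \in C u} &
    {in s &, forall u w, u != w ->
       if edge u w then mono (f u) (f w) else (f u != f w) && ~~ edge (f u) (f w)}.
Proof.
move=> mono_sym step; elim=> [|v s IH] C; first by exists (fun=> x0).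
rewrite cons_uniq => /andP[vs us] /(step _ _ _ vs) [x xC /(IH _ us) [f fC fE]].
have f1 u : u \in s -> if edge v u then mono x (f u)
    else (x != f u) && ~~ edge x (f u).
  move=> /fC; rewrite /shrink; case: ifP => _; rewrite inE => /andP[_] //.
  by rewrite eq_sym andbC.
have f2 u : u \in s -> f u \in C u.
  by move=> /fC; rewrite /shrink; case: ifP => _; rewrite inE => /andP[].
have sv u : u \in s -> u == v = false.
  by move=> us'; apply: contraNF vs => /eqP <-.
exists (fun u => if u == v then x else f u).
  move=> u; rewrite inE; case: eqP => [-> _ //|_ /=]; exact: f2.
move=> u w; rewrite !inE; case: (eqVneq u v) => [->|_] /=.
  by case: (eqVneq w v) => [->|_] //= _ /f1.
case: (eqVneq w v) => [->|_] //= us' ws; last exact: fE.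
by move=> _; move: (f1 _ us'); rewrite edge_sym mono_sym [x == _]eq_sym [edge x _]edge_sym.
Qed.

Lemma induced_copy (col : {set G} -> bool) (b : bool) (f : H -> G) :
  (forall x y, mono x y -> edge x y && (col [set x; y] == b)) ->
  (forall u w, u != w ->
     if edge u w then mono (f u) (f w) else (f u != f w) && ~~ edge (f u) (f w)) ->
  exists2 S : {set G}, iso (induced S) H & monochromatic col S.
Proof.
move=> monoE fE.
have f_inj : injective f.
  move=> u w fuw; apply/eqP; apply/negPn/negP => /fE; rewrite fuw.
  by case: ifP => _; [move=> /monoE; rewrite edge_irr | rewrite eqxx].
have f_edge u w : edge (f u) (f w) = edge u w.
  case: (eqVneq u w) => [->|/fE]; first by rewrite !edge_irr.
  by case: ifP => _; [move=> /monoE /andP[-> _] | move=> /andP[_ /negbTE ->]].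
pose S := f @: [set: H]; exists S; last first.
  exists b => x y /imsetP[u _ ->] /imsetP[w _ ->]; rewrite f_edge => uw.
  have /fE : u != w by apply: contraTneq uw => ->; rewrite edge_irr.
  by rewrite uw => /monoE /andP[_ /eqP].
have fS u : f u \in S by rewrite imset_f ?inE.
pose F u : induced S := exist (fun x => x \in S) (f u) (fS u).
have F_inj : injective F by move=> u w /(congr1 val) /= /f_inj.
have F_onto z : exists u, F u == z.
  case: z => z zS; case/imsetP: (zS) => u _ zu; exists u.
  by apply/eqP/val_inj; rewrite /= zu.
pose F' z := xchoose (F_onto z).
have F'K : cancel F' F by move=> z; exact/eqP/(xchooseP (F_onto z)).
have FK : cancel F F' by move=> u; apply: F_inj; rewrite F'K.
exists F'; first by exists F.
move=> y z; rewrite -{2}(F'K y) -{2}(F'K z); symmetry; exact: f_edge.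
Qed.
End Greedy.

(** * Vertices of typical degree *)

Section Typical.
Variables (R : realFieldType) (G : sgraph) (p Xi g sigma : R) (k : nat).
Hypotheses (jum : jumbled (@edge G) p Xi).
Hypotheses (p_gt0 : 0 < p) (g_gt0 : 0 < g) (g_le1 : g <= 1) (pg : 2 * p <= g).
Hypotheses (sigma_big : 1 <= g * sigma) (Xi_small : k%:R * Xi <= g ^+ 2 * p * sigma ^+ 2).

Lemma sigma_gt0 : 0 < sigma.
Proof. by rewrite -(pmulr_rgt0 _ g_gt0); apply: lt_le_trans ltr01 _. Qed.

Definition atypical (I : Type) (C : I -> {set G}) (x : G) (u : I) :=
  g * p * #|C u|%:R < `|deg R (@edge G) x (C u) - p * #|C u|%:R|.

(** An atypical vertex contributes more than g p sigma to the total deviation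
    Xi of the degrees into C u; take the union over the at most k sets. *)
Lemma few_atypical (I : eqType) (s : seq I) (C : I -> {set G}) (X : {set G}) :
  (size s <= k)%N -> (forall u, u \in s -> sigma <= #|C u|%:R) ->
  #|[set x in X | has (atypical C x) s]|%:R <= g * sigma.
Proof.
move=> sk sC; have s0 := sigma_gt0; have gps : 0 < g * p * sigma by rewrite !mulr_gt0.
have one u : u \in s -> #|[set x in X | atypical C x u]|%:R * (g * p * sigma) <= Xi.
  move=> us; apply: le_trans (jum (C u)).
  have gpC : 0 <= g * p * #|C u|%:R by rewrite !mulr_ge0 ?ler0n ?(ltW p_gt0) ?(ltW g_gt0).
  have := @markov_card R G (fun x => `|deg R (@edge G) x (C u) - p * #|C u|%:R|) X
     _ gpC (fun=> normr_ge0 _).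
  move=> h; apply: le_trans (le_trans h _).
  - by apply: ler_wpM2l => //; apply: ler_wpM2l; [rewrite mulr_ge0 ?(ltW p_gt0) ?(ltW g_gt0) | exact: sC].
  - by rewrite big_mkcond; apply: ler_sum => y _; case: ifP.
rewrite -(ler_pM2r gps).
have -> : g * sigma * (g * p * sigma) = g ^+ 2 * p * sigma ^+ 2 by ring.
apply: le_trans Xi_small.
apply: le_trans (_ : (\sum_(u <- s) #|[set x in X | atypical C x u]|)%N%:R * (g * p * sigma) <= _).
  by rewrite ler_pM2r // ler_nat; apply: union_card.
rewrite natr_sum mulr_suml.
apply: le_trans (_ : \sum_(u <- s) Xi <= _).
  by rewrite big_seq [leRHS]big_seq; apply: ler_sum => u; apply: one.
rewrite big_const_seq count_predT iter_addr_0 -[Xi *+ _]mulr_natl.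
by apply: ler_wpM2r; [exact: Xi_ge0 jum | rewrite ler_nat].
Qed.

(** A typical vertex has at most 2p|C u|, hence at most g|C u|, neighbours in
    C u, and the vertex itself accounts for another 1, at most g|C u|. *)
Lemma nonneighbours_card (I : Type) (C : I -> {set G}) (x : G) (u : I) :
  sigma <= #|C u|%:R -> ~~ atypical C x u ->
  (1 - 2 * g) * #|C u|%:R <= #|[set y in C u | ~~ edge x y & y != x]|%:R.
Proof.
move=> sC; rewrite /atypical -leNgt ler_norml => /andP[_].
rewrite degE; set N := #|[set y in C u | edge x y]|; set M := #|[set y in C u | _ & _]|.
have CNM : (#|C u| <= M + N + 1)%N.
  rewrite -(cards1 x) /M /N; apply: leq_trans (leq_add (leq_card_setU _ _) (leqnn _)).
  apply: leq_trans (leq_card_setU _ _); apply: subset_leq_card.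
  by apply/subsetP => y yC; rewrite !inE yC /=; case: (edge x y); case: (y == x).
move: CNM; rewrite -(ler_nat R) !natrD mulr1n.
move: sC; move: (#|C u|%:R : R) (M%:R : R) (N%:R : R) => c m n sc h1 h2.
have c0 : 0 <= c by apply: le_trans sc; exact/ltW/sigma_gt0.
have h3 : g * sigma <= g * c by rewrite ler_pM2l.
have h4 : 2 * p * c <= g * c by rewrite ler_wpM2r.
have h5 : g * (p * c) <= p * c by rewrite ler_piMl // mulr_ge0 // ltW.
have e1 := sigma_big; lra.
Qed.
End Typical.

(** * Degeneracy orders *)

Section Orders.
Variable H : sgraph.
Implicit Types (s : seq H) (u v : H).

(** As vertices are placed from the head of s, this is how many times the
    candidate set of u is still going to be restricted to a neighbourhood. *)
Definition back u s : nat := count (edge u) (take (index u s) s).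

Lemma back_cons u v s : u != v -> back u (v :: s) = (edge v u + back u s)%N.
Proof. by rewrite /back /= eq_sym => /negbTE ->; rewrite /= edge_sym. Qed.

(** The order is built from its end: a vertex of degree at most d in what is
    left comes last. *)
Lemma degenerate_order d : degenerate H d ->
  exists s : seq H, [/\ uniq s, forall u, u \in s & forall u, (back u s <= d)%N].
Proof.
move=> deg_H.
suff [s [us sS bs]] : exists s : seq H,
    [/\ uniq s, s =i [set: H] & {in s, forall u, (back u s <= d)%N}].
  by exists s; split => // u; rewrite ?bs ?sS ?inE.
move: [set: H] => S; move: {2}#|S| (erefl #|S|) => n; elim: n S => [|n IH] S.
  by move=> /eqP; rewrite cards_eq0 => /eqP ->; exists [::]; split => // x; rewrite inE.
move=> cS; pose eS := [rel x y : H | [&& x \in S, y \in S & edge x y]].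
have subS : is_subgraph S eS.
  split=> [x y /=|x y /and3P[-> -> ->] //]; rewrite edge_sym.
  by case: (x \in S); case: (y \in S).
have /(deg_H _ _ subS) [x xS dx] : S != set0 by rewrite -card_gt0 cS.
have [|s [us sS bs]] := IH (S :\ x); first by move: cS; rewrite (cardsD1 x) xS => -[].
have xs : x \notin s by rewrite sS !inE eqxx.
exists (rcons s x); split.
- by rewrite rcons_uniq xs.
- by move=> y; rewrite mem_rcons inE sS !inE; case: eqP => [->|].
move=> u; rewrite mem_rcons inE => /predU1P[->|us'].
  rewrite /back -cats1 index_cat (negbTE xs) /= eqxx addn0 take_size_cat //.
  apply: leq_trans dx; rewrite -size_filter -(card_uniqP _) ?filter_uniq //.
  apply: subset_leq_card; apply/subsetP => y; rewrite mem_filter sS !inE /= xS.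
  by case/and3P => -> _ ->.
rewrite /back -cats1 index_cat us' takel_cat ?index_size //; exact: bs.
Qed.
End Orders.

(** * Embedding in red when there is no sparse pair *)

(** Below, 2g bounds the proportion of candidates lost by a vertex that is not
    adjacent to the one being placed, and sigma bounds from below the sizes of
    all candidate sets up to the end. *)
Section DenseGreedy.
Variables (R : realFieldType) (H G : sgraph) (red : rel G).
Variables (p Xi g sigma eps t : R) (k : nat) (U : {set G}).
Hypotheses (jum : jumbled (@edge G) p Xi).
Hypotheses (p_gt0 : 0 < p) (g_gt0 : 0 < g) (g_small : 16 * g <= 1) (pg : 2 * p <= g).
Hypotheses (sigma_big : 1 <= g * sigma) (Xi_small : k%:R * Xi <= g ^+ 2 * p * sigma ^+ 2).
Hypotheses (eps_gt0 : 0 < eps) (eps_le1 : eps <= 1).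
Hypotheses (k_gt0 : (0 < k)%N) (t_ge0 : 0 <= t) (t_small : 2 * k%:R * t <= sigma).
Hypothesis red_sym : symmetric red.
Hypothesis dense : forall A B : {set G}, A \subset U -> B \subset U ->
  t <= #|A|%:R -> t <= #|B|%:R -> eps * #|A|%:R * #|B|%:R < npairs R red A B.

(** The factors after |C u| anticipate the losses to come, so that the bound
    reads |C u| >= sigma when u is about to be placed. *)
Definition dense_inv (s : seq H) (C : H -> {set G}) : Prop :=
  (size s <= k)%N /\ forall u, u \in s -> C u \subset U /\
    sigma <= #|C u|%:R * eps ^+ back u s * (1 - 2 * g) ^+ size s.

(** If more than t vertices x in C v had red degree less than eps|C u| into C u,
    they would form a sparse pair with C u.  So the vertices u contribute at most
    kt <= sigma/2 such x, and at most g sigma <= sigma/16 candidates are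
    atypical: some candidate is neither. *)
Lemma dense_step v s C : v \notin s -> dense_inv (v :: s) C ->
  exists2 x, x \in C v & dense_inv s (shrink red v x C).
Proof.
move=> vs [sk inv].
have g1 : g <= 1 by have := g_small; have := g_gt0; lra.
have s0 : 0 < sigma := sigma_gt0 g_gt0 sigma_big.
have gam0 : 0 <= 1 - 2 * g by have := g_small; have := g_gt0; lra.
have gam1 : 1 - 2 * g <= 1 by have := g_gt0; lra.
have t_sigma : t <= sigma.
  apply: le_trans t_small; rewrite ler_peMl // (_ : 2 * k%:R = (2 * k)%N%:R).
    by rewrite ler1n muln_gt0.
  by rewrite natrM.
have sC u : u \in v :: s -> sigma <= #|C u|%:R.
  move=> /inv [_ h]; apply: le_trans h _; rewrite -mulrA ler_piMr //.
  by rewrite mulr_ile1 ?exprn_ge0 ?exprn_ile1 ?(ltW eps_gt0).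
have sk' : (size s <= k)%N by apply: leq_trans sk => /=.
pose bad1 := [set x in C v | has (atypical p g C x) s].
have hbad1 : #|bad1|%:R <= g * sigma.
  apply: (few_atypical jum p_gt0 g_gt0 sigma_big Xi_small _ sk') => u us.
  by apply: sC; rewrite inE us orbT.
pose P u x := edge v u && (deg R red x (C u) < eps * #|C u|%:R).
pose bad2 := [set x in C v | has (P^~ x) s].
have one u : u \in s -> #|[set x in C v | P u x]|%:R <= t.
  move=> us; set A := [set _ in _ | _]; rewrite leNgt; apply/negP => tA.
  have us1 : u \in v :: s by rewrite inE us orbT.
  have [Cu _] := inv u us1; have [Cv _] := inv v (mem_head _ _).
  have AU : A \subset U.
    by apply: subset_trans Cv; apply/subsetP => x; rewrite inE => /andP[].
  have := dense AU Cu (ltW tA) (le_trans t_sigma (sC u us1)).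
  rewrite ltNge => /negP; apply.
  rewrite mulrAC mulrC mulr_natl -sumr_const; apply: ler_sum => x.
  by rewrite inE => /and3P[_ _ /ltW].
have hbad2 : #|bad2|%:R <= k%:R * t.
  apply: le_trans (_ : (\sum_(u <- s) #|[set x in C v | P u x]|)%N%:R <= _).
    by rewrite ler_nat; apply: union_card.
  rewrite natr_sum.
  apply: le_trans (_ : \sum_(u <- s) t <= _).
    by rewrite big_seq [leRHS]big_seq; apply: ler_sum => u; apply: one.
  rewrite big_const_seq count_predT iter_addr_0 -[t *+ _]mulr_natl.
  by apply: ler_wpM2r; rewrite ?ler_nat.
have [x xC xbad] : exists2 x, x \in C v & x \notin bad1 :|: bad2.
  case: (boolP [exists x in C v, x \notin bad1 :|: bad2]) => [/exists_inP //|].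
  rewrite negb_exists_in => /forall_inP h.
  have : #|C v|%:R <= #|bad1|%:R + #|bad2|%:R :> R.
    rewrite -natrD ler_nat; apply: leq_trans (leq_card_setU _ _).
    by apply: subset_leq_card; apply/subsetP => x /h; rewrite negbK.
  have := sC v (mem_head _ _); have : g * sigma <= 1 / 16 * sigma.
    by rewrite ler_pM2r //; have := g_small; lra.
  have := t_small; lra.
move: xbad; rewrite !inE xC /= negb_or => /andP[/hasPn typ /hasPn nbad].
exists x => //; split => // u us.
have us1 : u \in v :: s by rewrite inE us orbT.
have uv : u != v by apply: contraNneq vs => <-.
have [CU] := inv u us1; rewrite (back_cons _ uv) exprD /= exprS => h.
split.
  apply: subset_trans CU; rewrite /shrink.
  by case: ifP => _; apply/subsetP => y; rewrite inE => /andP[].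
apply: le_trans h _; rewrite mulrA mulrAC.
set B := _ ^+ back u s; set D := _ ^+ size s.
have B0 : 0 <= B by rewrite exprn_ge0 // ltW.
have D0 : 0 <= D by rewrite exprn_ge0.
rewrite [leLHS](_ : _ = #|C u|%:R * (1 - 2 * g) * eps ^+ edge v u * (B * D)); last by ring.
rewrite -[leRHS]mulrA; apply: ler_wpM2r; first by rewrite mulr_ge0.
have := typ u us; have := nbad u us; rewrite /shrink /P; case: (edge v u) => /=.
  rewrite -leNgt degE expr1 => hd _; apply: le_trans hd.
  by rewrite mulrC ler_pM2l // ler_piMr.
by move=> _ nt; rewrite mulr1 mulrC; apply: nonneighbours_card (sC u us1) nt.
Qed.

Lemma dense_embedding (s : seq H) : uniq s -> (forall u, u \in s) -> (size s <= k)%N ->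
  (forall u, sigma <= #|U|%:R * eps ^+ back u s * (1 - 2 * g) ^+ size s) ->
  exists f : H -> G, forall u w, u != w ->
    if edge u w then red (f u) (f w) else (f u != f w) && ~~ edge (f u) (f w).
Proof.
move=> us allS sk big; case: s us allS sk big => [|v s] us allS sk big.
  have noH (u : H) : False by have := allS u.
  by exists (fun u => False_rect G (noH u)) => u; case: (noH u).
have [x0 _] : exists x0, x0 \in U.
  apply/set0Pn; rewrite -card_gt0 lt0n; apply/eqP => U0.
  have := big v; rewrite U0 !mul0r leNgt => /negP; apply.
  exact: sigma_gt0 g_gt0 sigma_big.
have [f _ fE] := greedy_embedding x0 red_sym dense_step us (conj sk (fun u _ => conj (subxx U) (big u))).
by exists f => u w; apply: fE.
Qed.
End DenseGreedy.

(** * Embedding in blue between sets of low red density *)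

Lemma bernoulli_le (R : realFieldType) (x : R) n : 0 <= x <= 1 ->
  1 - n%:R * x <= (1 - x) ^+ n.
Proof.
move=> /andP[x0 x1]; elim: n => [|n IH]; first by rewrite mul0r subr0.
rewrite exprS -natr1; have h : (1 - x) * (1 - n%:R * x) <= (1 - x) * (1 - x) ^+ n.
  by apply: ler_wpM2l => //; rewrite subr_ge0.
apply: le_trans h; have : 0 <= n%:R * x * x by rewrite !mulr_ge0.
lra.
Qed.

Section SparseGreedy.
Variables (R : realFieldType) (H G : sgraph) (red : rel G).
Variables (p Xi g sigma : R) (k : nat).
Hypotheses (jum : jumbled (@edge G) p Xi).
Hypotheses (p_gt0 : 0 < p) (g_gt0 : 0 < g) (gk : 16 * g * k%:R <= 1) (k_gt0 : (0 < k)%N).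
Hypotheses (pg : 2 * p <= g) (sigma_big : 1 <= g * sigma).
Hypothesis (Xi_small : 2 * k%:R ^+ 2 * Xi <= g ^+ 3 * p ^+ 3 * sigma ^+ 2).
Hypothesis (red_sym : symmetric red).

Let blue : rel G := fun x y => edge x y && ~~ red x y.
Let gam : R := 1 - 2 * g.
Let dens (A B : {set G}) : R := npairs R red A B / (#|A|%:R * #|B|%:R).
Definition potential (s : seq H) (C : H -> {set G}) : R :=
  \sum_(u <- s) \sum_(w <- s | edge u w) dens (C u) (C w).

(** Each step may multiply the potential by gam^-4: gam^-2 for the losses in
    the sizes of two candidate sets, gam^-1 for averaging over the good
    candidates only, and gam^-1 to absorb the additive error tau0.  As
    gam^(4k) >= 1/2, the whole process at most doubles it. *)
Definition sparse_inv (s : seq H) (C : H -> {set G}) : Prop :=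
  [/\ (size s <= k)%N,
      forall u, u \in s -> sigma <= #|C u|%:R * p ^+ back u s * gam ^+ size s
    & potential s C <= g ^+ 2 * p * gam ^+ (4 * size s)].

Let k_ge1 : 1 <= k%:R :> R. Proof. by rewrite ler1n. Qed.
Let g_small : 16 * g <= 1.
Proof.
have h : 16 * g <= 16 * g * k%:R by rewrite ler_peMr // mulr_ge0 // ltW.
exact: le_trans h gk.
Qed.
Let p_le1 : p <= 1. Proof. have := pg; have := g_small; have := g_gt0; lra. Qed.
Let gam_gt0 : 0 < gam. Proof. rewrite /gam; have := g_small; have := g_gt0; lra. Qed.
Let gam_le1 : gam <= 1. Proof. rewrite /gam; have := g_gt0; lra. Qed.
Let sigma0 : 0 < sigma := sigma_gt0 g_gt0 sigma_big.
Let Xi0 : 0 <= Xi := Xi_ge0 jum.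

Let gam_pow n : (n <= 4 * k)%N -> 1 / 2 <= gam ^+ n.
Proof.
move=> nk; have g01 : 0 <= 2 * g <= 1 by have := g_small; have := g_gt0; lra.
apply: le_trans (bernoulli_le n g01).
have : n%:R * (2 * g) <= (4 * k)%N%:R * (2 * g) by rewrite ler_wpM2r ?ler_nat //; lra.
rewrite natrM; have := gk; lra.
Qed.

Let Xi_small1 : k%:R * Xi <= g ^+ 2 * p * sigma ^+ 2.
Proof.
apply: le_trans (_ : 2 * k%:R ^+ 2 * Xi <= _).
  apply: ler_wpM2r => //; rewrite expr2 mulrA ler_peMl ?ler0n //.
  have := k_ge1; lra.
apply: le_trans Xi_small _; rewrite ler_wpM2r ?sqr_ge0 //.
rewrite (_ : g ^+ 3 * p ^+ 3 = g ^+ 2 * p * (g * p ^+ 2)); last by ring.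
rewrite ler_piMr ?mulr_ge0 ?exprn_ge0 ?(ltW p_gt0) ?(ltW g_gt0) //.
rewrite mulr_ile1 ?exprn_ge0 ?exprn_ile1 ?(ltW p_gt0) ?(ltW g_gt0) //.
have := g_small; have := g_gt0; lra.
Qed.

Let dens_ge0 A B : 0 <= dens A B.
Proof. by rewrite divr_ge0 ?mulr_ge0 ?ler0n ?npairs_ge0. Qed.

(** Red pairs that survive when only the adjacency to x in the host graph is
    imposed, regardless of the colour.  This upper bound is what
    pseudo-randomness controls. *)
Let mask (b b' : bool) (x : G) (Y Z : {set G}) : R :=
  \sum_(y in Y) \sum_(z in Z) [&& red y z, b ==> edge x y & b' ==> edge x z]%:R.

(** The expected proportion of a candidate set that survives. *)
Let phi (b : bool) : R := if b then p else 1.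

Let phi_ge b : p <= phi b. Proof. by rewrite /phi; case: b. Qed.
Let phi_gt0 b : 0 < phi b. Proof. exact: lt_le_trans (phi_ge b). Qed.

(** A typical x has about p|C u| neighbours in C u, of which only a proportion g
    can be red if its red degree is low, hence almost all are blue. *)
Let shrink_card v x (C : H -> {set G}) u : sigma <= #|C u|%:R -> ~~ atypical p g C x u ->
  (edge v u -> deg R red x (C u) <= g * p * #|C u|%:R) ->
  gam * phi (edge v u) * #|C u|%:R <= #|shrink blue v x C u|%:R.
Proof.
move=> sC typ; rewrite /shrink /phi; case: ifP => _; last first.
  have g1 : g <= 1 by have := g_small; have := g_gt0; lra.
  by move=> _; rewrite mulr1; exact: (nonneighbours_card p_gt0 g_gt0 g1 pg sigma_big sC typ).
move=> /(_ isT) hred.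
move: typ; rewrite /atypical -leNgt ler_norml => /andP[+ _]; rewrite degE => h.
have : (#|[set y in C u | edge x y]| <=
   #|[set y in C u | blue x y]| + #|[set y in C u | red x y]|)%N.
  apply: leq_trans (leq_card_setU _ _); apply: subset_leq_card.
  by apply/subsetP => y; rewrite !inE /blue => /andP[-> ->]; case: (red x y).
rewrite -(ler_nat R) natrD; move: hred; rewrite degE /gam.
move: (#|C u|%:R : R) (#|[set y in C u | edge x y]|%:R : R)
  (#|[set y in C u | blue x y]|%:R : R) (#|[set y in C u | red x y]|%:R : R) h.
move=> c m b r *; lra.
Qed.

Let dens_shrink v x (C : H -> {set G}) u w :
  sigma <= #|C u|%:R -> sigma <= #|C w|%:R ->
  gam * phi (edge v u) * #|C u|%:R <= #|shrink blue v x C u|%:R ->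
  gam * phi (edge v w) * #|C w|%:R <= #|shrink blue v x C w|%:R ->
  dens (shrink blue v x C u) (shrink blue v x C w) <=
  gam ^- 2 * (mask (edge v u) (edge v w) x (C u) (C w) /
     (phi (edge v u) * phi (edge v w) * (#|C u|%:R * #|C w|%:R))).
Proof.
move=> su sw hu hw; have cu := lt_le_trans sigma0 su; have cw := lt_le_trans sigma0 sw.
have pos b (c : R) : 0 < c -> 0 < gam * phi b * c by move=> c0; rewrite !mulr_gt0.
have num : npairs R red (shrink blue v x C u) (shrink blue v x C w) <=
   mask (edge v u) (edge v w) x (C u) (C w).
  rewrite /npairs /deg /mask big_mkcond [leRHS]big_mkcond; apply: ler_sum => y _.
  rewrite big_mkcond [in leRHS]big_mkcond /= /shrink /blue.
  case: (boolP (y \in C u)) => yC; last first.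
    by rewrite [_ \in _](_ : _ = false) //; case: ifP => _; rewrite inE (negbTE yC).
  case: ifP => [|_]; last first.
    by apply: sumr_ge0 => z _; case: ifP.
  move=> hy; apply: ler_sum => z _; case: (boolP (z \in C w)) => zC; last first.
    by rewrite [_ \in _](_ : _ = false) //; case: ifP => _; rewrite inE (negbTE zC).
  case: ifP => // hz; rewrite ler_nat.
  have -> : edge v u ==> edge x y.
    by move: hy; case: ifP => // _; rewrite inE => /and3P[].
  have -> : edge v w ==> edge x z.
    by move: hz; case: ifP => // _; rewrite inE => /and3P[].
  by rewrite !andbT.
rewrite /dens; have m0 : 0 <= mask (edge v u) (edge v w) x (C u) (C w).
  by apply: le_trans num; apply: npairs_ge0.
apply: le_trans (ler_wpM2r _ num) _; first by rewrite invr_ge0 mulr_ge0.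
rewrite mulrCA; apply: ler_wpM2l => //; rewrite -invfM lef_pV2; last 2 first.
- rewrite posrE mulr_gt0 //; [exact: lt_le_trans (pos _ _ cu) hu | exact: lt_le_trans (pos _ _ cw) hw].
- by rewrite posrE !mulr_gt0 ?exprn_gt0.
apply: le_trans (ler_pM (ltW (pos _ _ cu)) (ltW (pos _ _ cw)) hu hw).
by apply: eq_ler; ring.
Qed.

Let tau0 : R := 2 * Xi / (p ^+ 2 * sigma ^+ 2).

Let tau_ge0 : 0 <= tau0.
Proof. by apply: divr_ge0; apply: mulr_ge0; rewrite ?sqr_ge0. Qed.

(** On average over x in X, restricting Y and Z does not raise the red density,
    up to an error tau0. *)
Let mask_average b b' (X Y Z : {set G}) :
  sigma <= #|X|%:R -> sigma <= #|Y|%:R -> sigma <= #|Z|%:R ->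
  \sum_(x in X) mask b b' x Y Z / (phi b * phi b' * (#|Y|%:R * #|Z|%:R)) <=
  #|X|%:R * (dens Y Z + tau0).
Proof.
move=> sX sY sZ; rewrite -mulr_suml.
have := @sum_restrict R G (@edge G) p Xi (@edge_sym G) jum (ltW p_gt0) b b' red X Y Z p_le1.
rewrite -/(phi b) -/(phi b') -/(mask b b' _ Y Z) /dens.
have X0 := lt_le_trans sigma0 sX; have Y0 := lt_le_trans sigma0 sY.
have Z0 := lt_le_trans sigma0 sZ.
rewrite ler_pdivrMr ?mulr_gt0 //; move/le_trans; apply.
move: (npairs R red Y Z) sX sY sZ X0 Y0 Z0.
move: (#|X|%:R : R) (#|Y|%:R : R) (#|Z|%:R : R) => x y z np sX sY sZ X0 Y0 Z0.
have s2 (a c : R) : sigma <= a -> sigma <= c -> 1 <= a * c / sigma ^+ 2.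
  move=> sa sc; rewrite ler_pdivlMr ?exprn_gt0 // mul1r expr2.
  by apply: ler_pM => //; apply: ltW sigma0.
have pp : 1 <= phi b * phi b' / p ^+ 2.
  rewrite ler_pdivlMr ?exprn_gt0 // mul1r expr2.
  by apply: ler_pM => //; apply: ltW p_gt0.
have -> : x * (np / (y * z) + tau0) * (phi b * phi b' * (y * z)) =
   x * phi b * phi b' * np + 2 * Xi * (phi b * phi b' / p ^+ 2) * (x * y * z / sigma ^+ 2).
  by rewrite /tau0; field; rewrite !gt_eqF.
rewrite lerD2l.
have h0 : 0 <= x * y * z / sigma ^+ 2 by rewrite divr_ge0 ?mulr_ge0 ?sqr_ge0 // ltW.
apply: le_trans (_ : 2 * Xi * (x * y * z / sigma ^+ 2) <= _); last first.
  by apply: ler_wpM2r => //; rewrite ler_peMr // mulr_ge0.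
have hy : y <= x * y * z / sigma ^+ 2.
  have -> : x * y * z / sigma ^+ 2 = y * (x * z / sigma ^+ 2) by field; rewrite gt_eqF.
  by rewrite ler_peMr ?s2 // ltW.
have hz : z <= x * y * z / sigma ^+ 2.
  by rewrite [x * y * z]mulrC -mulrA ler_peMr ?s2 // ltW.
apply: le_trans (_ : (2 * (x * y * z / sigma ^+ 2)) * Xi <= _); last by lra.
by apply: ler_wpM2r => //; lra.
Qed.

Let tau_small : k%:R ^+ 2 * tau0 <= g * (g ^+ 2 * p).
Proof.
have -> : k%:R ^+ 2 * tau0 = (2 * k%:R ^+ 2 * Xi) / (p ^+ 2 * sigma ^+ 2).
  by rewrite /tau0; ring.
rewrite ler_pdivrMr ?mulr_gt0 ?exprn_gt0 //; apply: le_trans Xi_small _.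
by apply: eq_ler; ring.
Qed.

Lemma potential_ge0 s C : 0 <= potential s C.
Proof. by apply: sumr_ge0 => u _; apply: sumr_ge0 => w _; apply: dens_ge0. Qed.

Lemma potential_cons v s C :
  potential s C + \sum_(w <- s | edge v w) dens (C v) (C w) <= potential (v :: s) C.
Proof.
rewrite /potential big_cons addrC; apply: lerD.
  by rewrite big_cons edge_irr.
apply: ler_sum => u _; rewrite [leRHS]big_cons; case: ifP => // _.
by rewrite lerDr.
Qed.

(** The potential bounds the red density from C v to each C u with uv an edge,
    so by Markov's inequality few x in C v have a large red degree into one of
    them.  Let D be the set of the remaining, typical x.  Since D is almost all
    of C v, the average over D of the new potential exceeds the old one only
    slightly, and some x in D does at least as well as the average. *)
Lemma sparse_step v s C : v \notin s -> sparse_inv (v :: s) C ->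
  exists2 x, x \in C v & sparse_inv s (shrink blue v x C).
Proof.
move=> vs [sk inv pot].
have sC u : u \in v :: s -> sigma <= #|C u|%:R.
  move=> /inv h; apply: le_trans h _; rewrite -mulrA ler_piMr //.
  by rewrite mulr_ile1 ?exprn_ge0 ?exprn_ile1 ?(ltW p_gt0) ?(ltW gam_gt0).
have sk' : (size s <= k)%N by apply: leq_trans sk => /=.
have sCs u : u \in s -> sigma <= #|C u|%:R by move=> us; apply: sC; rewrite inE us orbT.
have sv := sC v (mem_head _ _); have cv := lt_le_trans sigma0 sv.
pose bad1 := [set x in C v | has (atypical p g C x) s].
have hbad1 : #|bad1|%:R <= g * sigma.
  exact: (few_atypical jum p_gt0 g_gt0 sigma_big Xi_small1 _ sk').
pose P u x := edge v u && (g * p * #|C u|%:R < deg R red x (C u)).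
pose bad2 := [set x in C v | has (P^~ x) s].
have gp0 : 0 < g * p by rewrite mulr_gt0.
have one u : u \in s -> #|[set x in C v | P u x]|%:R <=
    #|C v|%:R / (g * p) * (if edge v u then dens (C v) (C u) else 0).
  move=> us; rewrite /P; case: ifP => _ /=; last first.
    by rewrite mulr0 (_ : [set _ in _ | _] = set0) ?cards0 //; apply/setP => x; rewrite !inE andbF.
  have cu := lt_le_trans sigma0 (sCs u us).
  have hm := @markov_card R G (fun x => deg R red x (C u)) (C v) _
    (ltW (mulr_gt0 gp0 cu)) (fun=> deg_ge0 _ _ _ _).
  rewrite -(ler_pM2r (mulr_gt0 gp0 cu)); apply: le_trans hm _.
  rewrite -/(npairs R red (C v) (C u)) /dens.
  by apply: eq_ler; field; rewrite !gt_eqF.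
have hbad2 : #|bad2|%:R <= g * #|C v|%:R.
  apply: le_trans (_ : (\sum_(u <- s) #|[set x in C v | P u x]|)%N%:R <= _).
    by rewrite ler_nat; apply: union_card.
  rewrite natr_sum big_seq; apply: le_trans (ler_sum _ one) _.
  rewrite -big_seq -mulr_sumr -big_mkcond /=.
  have : \sum_(w <- s | edge v w) dens (C v) (C w) <= g ^+ 2 * p.
    apply: le_trans (_ : potential (v :: s) C <= _).
      by apply: le_trans (potential_cons _ _ _); rewrite lerDr potential_ge0.
    apply: le_trans pot _; rewrite ler_piMr ?mulr_ge0 ?exprn_ge0 ?(ltW p_gt0) ?(ltW g_gt0) //.
    by rewrite exprn_ile1 // ltW.
  move=> h; apply: le_trans (ler_wpM2l _ h) _; first by rewrite divr_ge0 // ltW.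
  by apply: eq_ler; field; rewrite !gt_eqF.
pose D := C v :\: (bad1 :|: bad2).
have cD : gam * #|C v|%:R <= #|D|%:R.
  have : (#|C v| <= #|D| + (#|bad1| + #|bad2|))%N.
    apply: leq_trans (leq_add (leqnn _) (leq_card_setU _ _)).
    apply: leq_trans (leq_card_setU _ _); apply: subset_leq_card.
    by apply/subsetP => x xC; rewrite /D !inE xC andbT orNb.
  rewrite -(ler_nat R) !natrD /gam.
  have : g * sigma <= g * #|C v|%:R by rewrite ler_pM2l.
  lra.
have D0 : 0 < #|D|%:R :> R by apply: lt_le_trans cD; rewrite mulr_gt0.
have DC x : x \in D -> x \in C v by rewrite inE => /andP[].
have grow x u : x \in D -> u \in s ->
    gam * phi (edge v u) * #|C u|%:R <= #|shrink blue v x C u|%:R.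
  move=> xD us; move: (xD); rewrite !inE (DC x xD) /= andbT negb_or.
  move=> /andP[/hasPn /(_ u us) typ /hasPn /(_ u us)]; rewrite /P => hP.
  by apply: shrink_card typ _ => //; [exact: sCs | move=> vu; move: hP; rewrite vu -leNgt].
have avg : \sum_(x in D) potential s (shrink blue v x C) <=
    #|D|%:R * (gam ^- 3 * (potential s C + k%:R ^+ 2 * tau0)).
  (* F x bounds the new potential and makes sense for all x in C v. *)
  pose F x := gam ^- 2 * \sum_(u <- s) \sum_(w <- s | edge u w)
     mask (edge v u) (edge v w) x (C u) (C w) /
     (phi (edge v u) * phi (edge v w) * (#|C u|%:R * #|C w|%:R)).
  have mask0 b b' x Y Z : 0 <= mask b b' x Y Z.
    by apply: sumr_ge0 => y _; apply: sumr_ge0.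
  have F0 x : 0 <= F x.
    rewrite mulr_ge0 ?invr_ge0 ?exprn_ge0 ?(ltW gam_gt0) //.
    apply: sumr_ge0 => u _; apply: sumr_ge0 => w _.
    by rewrite divr_ge0 ?mulr_ge0 ?mask0 ?ler0n ?(ltW (phi_gt0 _)).
  apply: le_trans (_ : \sum_(x in C v) F x <= _).
    apply: le_trans (_ : \sum_(x in D) F x <= _).
      apply: ler_sum => x xD; rewrite /F mulr_sumr /potential big_seq [leRHS]big_seq.
      apply: ler_sum => u us; rewrite mulr_sumr big_seq_cond [leRHS]big_seq_cond.
      apply: ler_sum => w /andP[ws _].
      by apply: dens_shrink; rewrite ?sCs ?grow.
    rewrite big_mkcond [leRHS]big_mkcond; apply: ler_sum => x _.
    by case: ifP => [/DC -> //|_]; case: ifP.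
  rewrite /F -mulr_sumr exchange_big /=.
  apply: le_trans (_ : gam ^- 2 * (#|C v|%:R * (potential s C + k%:R ^+ 2 * tau0)) <= _).
    rewrite ler_wpM2l ?invr_ge0 ?exprn_ge0 ?(ltW gam_gt0) //.
    apply: le_trans (_ : #|C v|%:R * (potential s C + (size s)%:R ^+ 2 * tau0) <= _); last first.
      rewrite ler_wpM2l ?ler0n // lerD2l ler_wpM2r //.
      by rewrite lerXn2r ?nnegrE ?ler0n ?ler_nat.
    apply: le_trans (_ : \sum_(u <- s) \sum_(w <- s | edge u w) #|C v|%:R * (dens (C u) (C w) + tau0) <= _).
      rewrite big_seq [leRHS]big_seq; apply: ler_sum => u us.
      rewrite exchange_big /= big_seq_cond [leRHS]big_seq_cond.
      apply: ler_sum => w /andP[ws _]; exact: mask_average (sCs u us) (sCs w ws).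
    rewrite mulrDr /potential mulr_sumr.
    under eq_bigr do (under eq_bigr do rewrite mulrDr; rewrite big_split /= -mulr_sumr).
    rewrite big_split /= lerD2l.
    apply: le_trans (_ : \sum_(u <- s) \sum_(w <- s) #|C v|%:R * tau0 <= _).
      apply: ler_sum => u _; rewrite big_mkcond; apply: ler_sum => w _.
      by case: ifP => // _; rewrite mulr_ge0.
    rewrite !big_const_seq !count_predT !iter_addr_0 -mulrnA -[_ *+ (_ * _)]mulr_natr natrM expr2.
    by apply: eq_ler; ring.
  have Q0 : 0 <= potential s C + k%:R ^+ 2 * tau0.
    by rewrite addr_ge0 ?potential_ge0 // mulr_ge0 ?sqr_ge0 ?tau_ge0.
  apply: le_trans (_ : gam * #|C v|%:R * (gam ^- 3 * (potential s C + k%:R ^+ 2 * tau0)) <= _).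
    by apply: eq_ler; field; rewrite gt_eqF.
  by rewrite ler_wpM2r // mulr_ge0 // invr_ge0 exprn_ge0 // ltW.
have D1 : (0 < #|D|)%N by rewrite -(ltr0n R).
have [x xD hx] := exists_le_average D1 avg.
exists x; first exact: DC.
split=> // [u us|].
  have uv : u != v by apply: contraNneq vs => <-.
  have us1 : u \in v :: s by rewrite inE us orbT.
  have := inv u us1; rewrite (back_cons _ uv) exprD /= exprS => h.
  apply: le_trans h _; have := grow x u xD us.
  have -> : phi (edge v u) = p ^+ edge v u by rewrite /phi; case: (edge v u); rewrite ?expr1 ?expr0.
  set A := _ ^+ back u s; set B := _ ^+ size s; set E := p ^+ _ => h.
  have A0 : 0 <= A * B by rewrite mulr_ge0 ?exprn_ge0 // ltW.
  rewrite [leLHS](_ : _ = gam * E * #|C u|%:R * (A * B)); last by ring.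
  by rewrite -[leRHS]mulrA; apply: ler_wpM2r.
apply: le_trans hx _.
have pot' : potential s C <= g ^+ 2 * p * gam ^+ (4 * (size s).+1).
  by apply: le_trans pot; apply: le_trans (potential_cons _ _ _); rewrite lerDl; apply: sumr_ge0.
rewrite mulrC ler_pdivrMr ?exprn_gt0 //.
have e1 : gam ^+ (4 * size s) * gam ^+ 3 = gam ^+ (4 * size s + 3) by rewrite exprD.
have e2 : gam ^+ (4 * (size s).+1) = gam ^+ (4 * size s + 3) * gam.
  by rewrite -exprSr mulnS addnC !addnS addn0.
rewrite -[leRHS]mulrA e1; move: pot'; rewrite e2.
have : 1 / 2 <= gam ^+ (4 * size s + 3) by apply: gam_pow; apply: leq_trans (_ : (4 * (size s).+1 <= _)%N); rewrite ?leq_mul2l // mulnS addnC leq_add2r.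
have := tau_small; have gp2 : 0 <= g ^+ 2 * p by rewrite mulr_ge0 ?sqr_ge0 // ltW.
move: (gam ^+ _) => T h1 h2 h3.
have : (g ^+ 2 * p * g) * (1 / 2) <= (g ^+ 2 * p * g) * T.
  by apply: ler_wpM2l => //; rewrite mulr_ge0 // ltW.
by move: h3; rewrite /gam; lra.
Qed.

(** The density bound g^2 p / (2k^2) makes the initial potential, a sum of at
    most k^2 terms, half of what is tolerated at the end. *)
Lemma sparse_embedding (s : seq H) (W : H -> {set G}) :
  uniq s -> (forall u, u \in s) -> (size s <= k)%N ->
  (forall u, sigma <= #|W u|%:R * p ^+ back u s * (1 - 2 * g) ^+ size s) ->
  (forall u w, edge u w ->
     npairs R red (W u) (W w) * (2 * k%:R ^+ 2) <= g ^+ 2 * p * #|W u|%:R * #|W w|%:R) ->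
  exists f : H -> G, forall u w, u != w ->
    if edge u w then edge (f u) (f w) && ~~ red (f u) (f w)
    else (f u != f w) && ~~ edge (f u) (f w).
Proof.
move=> us allS sk big sparse; case: s us allS sk big => [|v s] us allS sk big.
  have noH (u : H) : False by have := allS u.
  by exists (fun u => False_rect G (noH u)) => u; case: (noH u).
have Wbig u : 0 < #|W u|%:R :> R.
  rewrite lt_neqAle eq_sym ler0n andbT; apply/eqP => U0.
  by have := big u; rewrite U0 !mul0r leNgt sigma0.
have [x0 _] : exists x0, x0 \in W v by apply/set0Pn; rewrite -card_gt0 -(ltr0n R).
have blue_sym : symmetric blue by move=> x y; rewrite /blue edge_sym red_sym.
have pot : potential (v :: s) W <= g ^+ 2 * p * gam ^+ (4 * size (v :: s)).
  set S := v :: s in sk *.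
  apply: le_trans (_ : g ^+ 2 * p * (1 / 2) <= _); last first.
    apply: ler_wpM2l; first by rewrite mulr_ge0 ?sqr_ge0 // ltW.
    by apply: gam_pow; rewrite leq_mul2l.
  have k20 : 0 < k%:R ^+ 2 :> R by rewrite exprn_gt0 // ltr0n.
  have c0 : 0 <= g ^+ 2 * p / (2 * k%:R ^+ 2).
    by rewrite divr_ge0 ?mulr_ge0 ?sqr_ge0 // ltW.
  apply: le_trans (_ : \sum_(u <- S) \sum_(w <- S) g ^+ 2 * p / (2 * k%:R ^+ 2) <= _).
    apply: ler_sum => u _; rewrite big_mkcond; apply: ler_sum => w _.
    case: ifP => // uw.
    rewrite /dens ler_pdivrMr ?(mulr_gt0 (Wbig u) (Wbig w)) //.
    rewrite mulrAC ler_pdivlMr ?(mulr_gt0 (ltr0Sn _ 1) k20) //.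
    by rewrite [leRHS]mulrA; apply: sparse.
  rewrite !big_const_seq !count_predT !iter_addr_0 -mulrnA -[_ *+ (_ * _)]mulr_natr natrM.
  have h : (size S)%:R * (size S)%:R <= k%:R ^+ 2 :> R.
    by rewrite expr2; apply: ler_pM; rewrite ?ler0n ?ler_nat.
  apply: le_trans (ler_wpM2l c0 h) _.
  by apply: eq_ler; field; rewrite gt_eqF // ltr0n.
have [f _ fE] := greedy_embedding x0 blue_sym sparse_step us (And3 sk (fun u _ => big u) pot).
by exists f => u w; apply: fE.
Qed.
End SparseGreedy.

(** * Many sets of pairwise low density *)

Section SparseFamily.
Variables (R : realFieldType) (V : finType) (red : rel V) (delta eps m : R).
Hypotheses (red_sym : symmetric red) (delta_gt0 : 0 < delta) (delta_le1 : delta <= 1).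
Hypotheses (eps_gt0 : 0 < eps) (m_gt0 : 0 < m).

Definition sparse_pair (U : {set V}) : Prop :=
  exists A B : {set V}, [/\ A \subset U, B \subset U,
    delta * #|U|%:R <= #|A|%:R, delta * #|U|%:R <= #|B|%:R
    & npairs R red A B <= eps * #|A|%:R * #|B|%:R].

Lemma npairs_le (A B : {set V}) (c : R) :
  (forall x, x \in A -> deg R red x B <= c) -> npairs R red A B <= #|A|%:R * c.
Proof.
by move=> h; rewrite mulr_natl -sumr_const; apply: ler_sum.
Qed.

(** Markov's inequality for each i: at most a proportion 1/(2|s|) of X exceeds
    the threshold t i, so at least half of X exceeds none. *)
Lemma trim_card (I : eqType) (s : seq I) (X : {set V}) (D : I -> V -> R) (t : I -> R) :
    (forall i, i \in s -> 0 < t i) -> (forall i x, 0 <= D i x) ->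
    (forall i, i \in s -> (\sum_(x in X) D i x) * (2 * (size s)%:R) <= t i * #|X|%:R) ->
    #|X|%:R / 2 <= #|[set x in X | ~~ has (fun i => t i < D i x) s]|%:R :> R.
Proof.
move=> t0 D0 hD; set X' := [set _ in _ | _].
pose bad i := [set x in X | t i < D i x].
have one i : i \in s -> #|bad i|%:R * (2 * (size s)%:R) <= #|X|%:R :> R.
  move=> si; have ti := t0 i si; rewrite -(ler_pM2l ti).
  apply: le_trans (hD i si); rewrite [leLHS]mulrA ler_wpM2r ?mulr_ge0 //.
  by rewrite mulrC; apply: markov_card (ltW ti) (D0 i).
have tot : (\sum_(i <- s) #|bad i|)%N%:R * 2 <= #|X|%:R :> R.
  case: (posnP (size s)) => [/size0nil -> |s0]; first by rewrite big_nil mul0r.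
  have s0' : 0 < (size s)%:R :> R by rewrite ltr0n.
  rewrite -(ler_pM2r s0') -mulrA natr_sum mulr_suml big_seq.
  apply: le_trans (ler_sum _ one) _.
  by rewrite -big_seq big_const_seq count_predT iter_addr_0 mulr_natr.
have : (#|X| <= #|X'| + \sum_(i <- s) #|bad i|)%N.
  apply: leq_trans (leq_add (leqnn _) (union_card s (fun i x => t i < D i x) X)).
  apply: leq_trans (leq_card_setU _ _); apply: subset_leq_card.
  by apply/subsetP => x xX; rewrite !inE xX /= orNb.
rewrite -(ler_nat R) natrD; lra.
Qed.

(** Recursing separately into the two sides of a sparse pair (A, B) could hit
    subsets of atypically high density.  So A is first trimmed to vertices of
    low degree into B, which makes every subset of A sparse to B.  After the
    recursion in A has produced 2^h sets, B is trimmed to vertices of low degree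
    into each of them, and the recursion in B yields 2^h further sets, sparse to
    the former.  Trimming against 2^h sets at once multiplies the density by
    2^(h+1). *)
Lemma sparse_family h (U : {set V}) :
  (forall U : {set V}, m <= #|U|%:R -> sparse_pair U) ->
  m * (2 / delta) ^+ h <= #|U|%:R ->
  exists W : nat -> {set V},
    (forall i, (i < 2 ^ h)%N -> W i \subset U /\ m <= #|W i|%:R) /\
    (forall i j, (i < 2 ^ h)%N -> (j < 2 ^ h)%N -> i != j ->
       npairs R red (W i) (W j) <= 2 ^+ h.+1 * eps * #|W i|%:R * #|W j|%:R).
Proof.
move=> hole; elim: h U => [|h IH] U.
  rewrite expr0 mulr1 => mU; exists (fun=> U); split => // i j.
  by rewrite !ltnS !leqn0 => /eqP -> /eqP ->.
have d1 : 1 <= 2 / delta by rewrite ler_pdivlMr //; have := delta_le1; lra.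
have dh : 0 <= m * (2 / delta) ^+ h.
  by rewrite mulr_ge0 ?exprn_ge0 ?(ltW m_gt0) // (le_trans ler01 d1).
move=> mU; have half (X : R) : delta * #|U|%:R <= X -> m * (2 / delta) ^+ h <= X / 2.
  move=> hX; have : delta * (m * (2 / delta) ^+ h.+1) <= X.
    by apply: le_trans hX; rewrite ler_pM2l.
  have -> : delta * (m * (2 / delta) ^+ h.+1) = 2 * (m * (2 / delta) ^+ h).
    by rewrite exprS; field; rewrite gt_eqF.
  by lra.
have U0 : 0 < #|U|%:R :> R.
  by apply: lt_le_trans mU; rewrite mulr_gt0 // exprn_gt0 // (lt_le_trans ltr01 d1).
have mU' : m <= #|U|%:R.
  by apply: le_trans mU; rewrite ler_peMr ?(ltW m_gt0) // exprn_ege1.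
have [A [B [AU BU cA cB sp]]] := hole U mU'.
have B0 : 0 < #|B|%:R :> R by apply: lt_le_trans cB; rewrite mulr_gt0.
(* A single threshold suffices on this side, hence the index list [:: tt]. *)
pose A' := [set x in A | ~~ has (fun _ => 2 * eps * #|B|%:R < deg R red x B) [:: tt]].
have cA' : #|A|%:R / 2 <= #|A'|%:R :> R.
  apply: (@trim_card unit [:: tt] A (fun _ x => deg R red x B)).
  - by move=> _ _; rewrite !mulr_gt0.
  - by move=> _ x; apply: deg_ge0.
  - by move=> _ _; move: sp; rewrite -/(npairs R red A B) /= mulr1; lra.
have [W1 [W1U W1sp]] := IH A' (le_trans (half _ cA) cA').
have W1pos i : (i < 2 ^ h)%N -> 0 < #|W1 i|%:R :> R.
  by move=> /W1U[_]; apply: lt_le_trans.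
have W1B i : (i < 2 ^ h)%N -> npairs R red (W1 i) B <= #|W1 i|%:R * (2 * eps * #|B|%:R).
  move=> /W1U[sub _]; apply: npairs_le => x /(subsetP sub); rewrite inE /= orbF -leNgt.
  by case/andP.
pose B' := [set y in B | ~~ has (fun i => 2 ^+ h.+2 * eps * #|W1 i|%:R < deg R red y (W1 i))
   (iota 0 (2 ^ h))].
have cB' : #|B|%:R / 2 <= #|B'|%:R :> R.
  apply: (@trim_card nat (iota 0 (2 ^ h)) B (fun i y => deg R red y (W1 i))).
  - move=> i; rewrite mem_iota add0n => /andP[_ /W1pos hi].
    by apply: mulr_gt0 => //; apply: mulr_gt0 => //; apply: exprn_gt0.
  - by move=> i x; apply: deg_ge0.
  - move=> i; rewrite mem_iota add0n => /andP[_ /W1B hi].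
    rewrite -/(npairs R red B (W1 i)) npairs_sym // size_iota natrX.
    have h2 : 0 <= 2 * 2 ^+ h :> R by rewrite mulr_ge0 ?exprn_ge0.
    apply: le_trans (ler_wpM2r h2 hi) _; rewrite !exprS.
    by apply: eq_ler; ring.
have [W2 [W2U W2sp]] := IH B' (le_trans (half _ cB) cB').
have cross i j : (i < 2 ^ h)%N -> (j < 2 ^ h)%N ->
    npairs R red (W2 j) (W1 i) <= 2 ^+ h.+2 * eps * #|W1 i|%:R * #|W2 j|%:R.
  move=> hi hj; have [sub _] := W2U j hj; rewrite mulrC; apply: npairs_le => y /(subsetP sub).
  rewrite inE => /andP[_ /hasPn/(_ i)]; rewrite mem_iota hi => /(_ isT).
  by rewrite -leNgt.
have grow i j (W : nat -> {set V}) :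
   npairs R red (W i) (W j) <= 2 ^+ h.+1 * eps * #|W i|%:R * #|W j|%:R ->
   npairs R red (W i) (W j) <= 2 ^+ h.+2 * eps * #|W i|%:R * #|W j|%:R.
  move/le_trans; apply; do 3 (apply: ler_wpM2r; rewrite ?ler0n ?(ltW eps_gt0) //).
  by rewrite ler_eXn2l // ltr1n.
have A'U : A' \subset U by apply: subset_trans AU; apply/subsetP => x; rewrite inE => /andP[].
have B'U : B' \subset U by apply: subset_trans BU; apply/subsetP => x; rewrite inE => /andP[].
have small i : (i < 2 ^ h.+1)%N -> (i < 2 ^ h)%N = false -> (i - 2 ^ h < 2 ^ h)%N.
  by move=> hi /negbT; rewrite -leqNgt => ih; rewrite ltn_subLR // addnn -mul2n -expnS.
exists (fun i => if (i < 2 ^ h)%N then W1 i else W2 (i - 2 ^ h)%N); split.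
  move=> i hi; case: ifP => hi1.
    by have [sub ?] := W1U i hi1; split => //; apply: subset_trans sub _.
  by have [sub ?] := W2U _ (small i hi hi1); split => //; apply: subset_trans sub _.
move=> i j hi hj ij; case: ifP => hi1; case: ifP => hj1.
- by apply: (grow i j W1); apply: W1sp.
- rewrite npairs_sym //; exact: cross hi1 (small _ hj hj1).
- by rewrite -mulrA [#|_|%:R * _]mulrC mulrA; exact: cross hj1 (small _ hi hi1).
- apply: (grow (i - 2 ^ h)%N (j - 2 ^ h)%N W2); apply: W2sp; rewrite ?small //.
  move: hi1 hj1 => /negbT; rewrite -leqNgt => hi1 /negbT; rewrite -leqNgt => hj1.
  by rewrite -(eqn_add2r (2 ^ h)) !subnK.
Qed.
End SparseFamily.

(** * An explicit pseudo-random graph of prescribed density *)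

Section AffineGraph.
Variables (F : finFieldType) (S : {set F}).

(** For fixed b the pairs (a, a') with ab + a' = c form a line, so the
    neighbourhood of a point is a union of |S| parallel lines.  Lines of
    distinct slopes meet in one point, whence the pairwise independence below. *)
Definition affine_rel : rel (F * F) := fun x y => x.1 * y.1 + x.2 + y.2 \in S.

Lemma affine_rel_sym : symmetric affine_rel.
Proof. by move=> x y; rewrite /affine_rel mulrC addrAC. Qed.

Definition affine_edge : rel (F * F) := fun x y => (x != y) && affine_rel x y.

Lemma affine_edge_sym : symmetric affine_edge.
Proof. by move=> x y; rewrite /affine_edge eq_sym affine_rel_sym. Qed.

Lemma affine_edge_irr : irreflexive affine_edge.
Proof. by move=> x; rewrite /affine_edge eqxx. Qed.

Definition affine_graph := SGraph affine_edge_sym affine_edge_irr.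

Variable R : realFieldType.
Let q : R := #|F|%:R.
Let p : R := #|S|%:R / q.

Let q_gt0 : 0 < q. Proof. by rewrite ltr0n; apply/card_gt0P; exists 0. Qed.

Let p01 : 0 <= p <= 1.
Proof.
rewrite divr_ge0 ?(ltW q_gt0) //= ler_pdivrMr // mul1r ler_nat.
by apply: subset_leq_card; apply/subsetP.
Qed.

Let sum_ind : \sum_(t : F) ((t \in S)%:R : R) = p * q.
Proof.
by rewrite /p divfK ?gt_eqF // -sum1_card natr_sum [RHS]big_mkcond; apply: eq_bigr => t _; case: ifP.
Qed.

Let dev x y : R := (affine_rel x y)%:R - p.

Let sum_dev0 : \sum_(t : F) ((t \in S)%:R - p) = 0 :> R.
Proof.
rewrite big_split /= sum_ind sumr_const -mulr_natl.
by rewrite -[#|_|%:R]/q; ring.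
Qed.

(** The map sending a to its values against b and b' is a bijection of F * F
    when b and b' have distinct slopes, so the two deviations are independent. *)
Let dev_orth (b b' : F * F) : b.1 != b'.1 -> \sum_a dev a b * dev a b' = 0.
Proof.
move=> bb; pose f (s t : F) : R := ((s \in S)%:R - p) * ((t \in S)%:R - p).
have -> : \sum_a dev a b * dev a b' = \sum_(u : F * F) f u.1 u.2.
  pose T (a : F * F) := (a.1 * b.1 + a.2 + b.2, a.1 * b'.1 + a.2 + b'.2).
  rewrite [RHS](reindex T) //=.
  have d0 : b.1 - b'.1 != 0 by rewrite subr_eq0.
  pose T' (u : F * F) := let a := (u.1 - u.2 - b.2 + b'.2) / (b.1 - b'.1) in
    (a, u.1 - b.2 - a * b.1).
  exists T' => [[a1 a2]|[u1 u2]] _; rewrite /T /T' /=; congr pair; field; exact: d0.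
rewrite -(pair_bigA _ f) /= /f.
by apply: big1 => s _; rewrite -mulr_sumr sum_dev0 mulr0.
Qed.

Let dev_le (b b' : F * F) : \sum_a dev a b * dev a b' <= q ^+ 2.
Proof.
apply: le_trans (_ : \sum_(a : F * F) 1 <= _); last first.
  by rewrite sumr_const -[1 *+ _]/(_%:R) card_prod natrM expr2.
apply: ler_sum => a _; rewrite /dev; move: (p) p01 => r /andP[r0 r1].
have r2 : 0 <= r * (1 - r) by rewrite mulr_ge0 // subr_ge0.
by case: (affine_rel a b); case: (affine_rel a b'); rewrite /= ?mulr1n ?mulr0n; lra.
Qed.

(** Only the at most q pairs (b, b') with equal slopes, for each b, contribute to
    the variance. *)
Let second_moment (B : {set F * F}) :
  \sum_a (deg R affine_rel a B - p * #|B|%:R) ^+ 2 <= #|B|%:R * q ^+ 3.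
Proof.
have E a : (deg R affine_rel a B - p * #|B|%:R) ^+ 2 =
    \sum_(b in B) \sum_(b' in B) dev a b * dev a b'.
  have -> : deg R affine_rel a B - p * #|B|%:R = \sum_(b in B) dev a b.
    by rewrite /dev sumrB sumr_const mulr_natr.
  by rewrite expr2 mulr_suml; apply: eq_bigr => b _; rewrite mulr_sumr.
under eq_bigr do rewrite E.
rewrite exchange_big /= mulr_natl -sumr_const; apply: ler_sum => b _.
rewrite exchange_big /=.
apply: le_trans (_ : \sum_(b' : F * F) (if b'.1 == b.1 then q ^+ 2 else 0) <= _).
  rewrite big_mkcond; apply: ler_sum => b' _.
  case: eqP => [_|/eqP bb]; case: ifP => _ //; first by rewrite sqr_ge0.
  by rewrite dev_orth // eq_sym.
rewrite -(pair_bigA _ (fun s t : F => if s == b.1 then q ^+ 2 else 0)) /=.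
rewrite (bigD1 b.1) //= eqxx [X in _ + X]big1 => [|s h]; last by rewrite (negbTE h) big1.
by rewrite sumr_const addr0 -mulr_natr -exprSr.
Qed.

(** With n = M^4 vertices the second moment is at most n^(5/2); passing to the
    first moment by |x| <= x^2 / (2 M^3) + M^3 / 2 gives n^(7/4) = M^7.  A loop
    changes each degree by at most 1, and n <= n^(7/4). *)
Lemma affine_graph_jumbled (M : R) : 0 < M -> M ^+ 4 = q ^+ 2 ->
  @jumbled R affine_graph (@edge affine_graph) p (2 * M ^+ 7).
Proof.
move=> M0 Mq B; have q1 : 1 <= q by rewrite ler1n; apply/card_gt0P; exists 0.
have M1 : 1 <= M.
  rewrite leNgt; apply/negP => M1; have : M ^+ 4 < 1 by rewrite exprn_ilt1 // ltW.
  by rewrite Mq; apply/negP; rewrite -leNgt exprn_ege1.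
have qM : q = M ^+ 2.
  apply/eqP; rewrite -(eqrXn2 (n := 2)) ?exprn_ge0 ?(ltW q_gt0) ?(ltW M0) //.
  by rewrite -Mq -exprM.
have cV : #|affine_graph|%:R = M ^+ 4 :> R by rewrite card_prod natrM Mq expr2.
have loop a : `|deg R affine_edge a B - p * #|B|%:R| <=
    1 + `|deg R affine_rel a B - p * #|B|%:R|.
  have : `|deg R affine_edge a B - deg R affine_rel a B| <= 1.
    rewrite /deg -sumrB; case: (boolP (a \in B)) => aB; last first.
      rewrite big1 ?normr0 // => b bB; rewrite /affine_edge.
      by rewrite (_ : a != b) ?subrr //; apply: contraNneq aB => ->.
    rewrite (bigD1 a) //= big1 => [|b /andP[_ ba]]; last by rewrite /affine_edge eq_sym ba subrr.
    rewrite /affine_edge eqxx /= addr0 sub0r normrN.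
    by case: (affine_rel a a); rewrite ?normr1 ?normr0.
  move=> h; rewrite -[X in X - p * _](subrK (deg R affine_rel a B)) -addrA.
  by apply: le_trans (ler_normD _ _) _; rewrite lerD2r.
apply: le_trans (ler_sum _ (fun a _ => loop a)) _.
rewrite big_split /= sumr_const -[1 *+ _]/(_%:R) cV.
have amgm (x : R) : `|x| <= x ^+ 2 / (2 * M ^+ 3) + M ^+ 3 / 2.
  have M3 : 0 < M ^+ 3 by rewrite exprn_gt0.
  rewrite -(ler_pM2r M3) mulrDl.
  have -> : x ^+ 2 / (2 * M ^+ 3) * M ^+ 3 = x ^+ 2 / 2 by field; rewrite gt_eqF.
  rewrite -(real_normK (num_real x)).
  have := sqr_ge0 (`|x| - M ^+ 3); move: `|x| (M ^+ 3) => y z; nra.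
apply: le_trans (lerD (lexx _) (ler_sum _ (fun a _ => amgm _))) _.
have cM : \sum_(a : affine_graph) M ^+ 3 / 2 = M ^+ 4 * (M ^+ 3 / 2).
  by rewrite sumr_const -[LHS]mulr_natl -cV.
rewrite big_split /= -mulr_suml cM.
have B_le : #|B|%:R <= M ^+ 4 :> R by rewrite -cV ler_nat max_card.
have M30 : 0 <= (2 * M ^+ 3)^-1 by rewrite invr_ge0 mulr_ge0 ?exprn_ge0 // ltW.
have sm : (\sum_(a : F * F) (deg R affine_rel a B - p * #|B|%:R) ^+ 2) <= M ^+ 4 * M ^+ 6.
  apply: le_trans (second_moment B) _; rewrite qM -exprM.
  by apply: ler_wpM2r => //; rewrite exprn_ge0 // ltW.
apply: le_trans (lerD (lexx _) (lerD (ler_wpM2r M30 sm) (lexx _))) _.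
have -> : M ^+ 4 * M ^+ 6 / (2 * M ^+ 3) = M ^+ 7 / 2 by field; rewrite gt_eqF.
have -> : M ^+ 4 * (M ^+ 3 / 2) = M ^+ 7 / 2 by field.
have : M ^+ 4 <= M ^+ 7 by rewrite ler_weXn2l.
lra.
Qed.
End AffineGraph.

Lemma jumbled_graph (R : realFieldType) (L j : nat) : (0 < L)%N -> (j <= 2 * L)%N ->
  exists2 G : sgraph, #|G| = (2 ^ (4 * L))%N &
    jumbled (@edge G) ((2 : R) ^- j) (2 ^+ (7 * L).+1).
Proof.
move=> L0 jL; have L20 : (0 < 2 * L)%N by rewrite muln_gt0.
have [F _ cF] := pPrimePowerField (isT : prime 2) L20.
have : (2 ^ (2 * L - j) <= #|F|)%N by rewrite cF leq_exp2l // leq_subr.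
case/card_geqP => s [us ss _]; pose S := [set x in s].
have cS : #|S| = (2 ^ (2 * L - j))%N by rewrite cardsE (card_uniqP us).
exists (affine_graph S); first by rewrite card_prod cF -expnD; congr (_ ^ _)%N; lia.
have := @affine_graph_jumbled F S R (2 ^+ L).
rewrite cS cF !natrX.
have -> : (2 : R) ^+ (2 * L - j) / 2 ^+ (2 * L) = 2 ^- j.
  rewrite -{2}(subnK jL) exprD; field; rewrite !gt_eqF ?exprn_gt0 //.
rewrite -!exprM -exprS [(L * 7)%N]mulnC; apply; first by rewrite exprn_gt0.
by rewrite mulnAC mulnC.
Qed.

(** * The host graph arrows H *)

Lemma pow2_le (R : realFieldType) (a b c : nat) : (a + c <= b)%N ->
  (2 : R) ^+ a <= 2 ^- c * 2 ^+ b.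
Proof.
move=> abc; rewrite mulrC ler_pdivlMr ?exprn_gt0 // -exprD.
by rewrite ler_weXn2l // ler1n.
Qed.

(** All parameters are powers of two, so that every constraint among them is a
    linear inequality between exponents.  With K = 2^kap >= k they are
    p = 1/(32K), g = 1/(16K), eps = 2^-16 K^-6 and delta = eps^d / (4K); the sets
    W_i have size at least m = n (delta/2)^h and sigma = m eps^d / 2.  The bound on
    L makes the total deviation Xi = 2 n^(7/4) of the degrees small enough for
    2 K^2 Xi <= g^3 p^3 sigma^2. *)
Lemma induced_arrow_host (R : realFieldType) (H : sgraph) (d kap h L : nat) (c : H -> nat) :
  degenerate H d -> (#|H| <= 2 ^ kap)%N -> (h <= kap.+1)%N ->
  (forall u, (c u < 2 ^ h)%N) -> (forall u w, edge u w -> c u != c w) ->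
  (31 + 8 * kap + 2 * (h * (d * (6 * kap + 16) + kap + 3)) + 2 * (d * (6 * kap + 16)) <= L)%N ->
  has_induced_ramsey_graph H (2 ^ (4 * L)).
Proof.
move=> degH cH hkap c_lt c_ok; set e := (6 * kap + 16)%N.
set de := (d * e)%N; set hx := (h * _)%N => LL.
have L0 : (0 < L)%N by lia.
have jL : (kap + 5 <= 2 * L)%N by lia.
have [G cG jum] := jumbled_graph R L0 jL; exists G => // col.
pose T := (4 * L - hx - de - 1)%N.
have T1 : (7 * L + 29 + 8 * kap <= 2 * T)%N by lia.
have TM : (4 * L = T + de + 1 + hx)%N by lia.
pose g : R := 2 ^- (kap + 4); pose p : R := 2 ^- (kap + 5); pose eps : R := 2 ^- e.
pose delta : R := 2 ^- (de + kap + 2); pose m : R := 2 ^+ (T + de + 1).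
pose sigma : R := 2 ^+ T; pose k := (2 ^ kap)%N; pose Xi : R := 2 ^+ (7 * L).+1.
have pos n : 0 < (2 : R) ^- n by rewrite invr_gt0 exprn_gt0.
have posX n : 0 < (2 : R) ^+ n by rewrite exprn_gt0.
have le1 n : (2 : R) ^- n <= 1 by rewrite invf_le1 // exprn_ege1 // ler1n.
have inv_mono a b : (a <= b)%N -> (2 : R) ^- b <= 2 ^- a.
  by move=> ab; rewrite lef_pV2 ?posrE // ler_weXn2l // ler1n.
have k_gt0 : (0 < k)%N by rewrite expn_gt0.
have kE : k%:R = 2 ^+ kap :> R by rewrite natrX.
have gk : 16 * g * k%:R <= 1.
  rewrite kE /g exprD; set X := 2 ^+ kap.
  by apply: eq_ler; field; rewrite gt_eqF //; exact: posX.
have pg : 2 * p <= g.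
  by rewrite /p /g addnS exprS invfM mulrA divff ?mul1r ?pnatr_eq0.
have sigma_big : 1 <= g * sigma by rewrite -(expr0 2); apply: pow2_le; lia.
have invX a n : ((2 : R) ^- a) ^+ n = 2 ^- (a * n) by rewrite exprVn exprM.
have invD a b : (2 : R) ^- a * 2 ^- b = 2 ^- (a + b) by rewrite -invfM exprD.
have Xi_sparse : 2 * k%:R ^+ 2 * Xi <= g ^+ 3 * p ^+ 3 * sigma ^+ 2.
  rewrite kE /Xi /g /p /sigma !invX invD -!exprM -exprS -exprD.
  by apply: pow2_le; lia.
have Xi_dense : k%:R * Xi <= g ^+ 2 * p * sigma ^+ 2.
  rewrite kE /Xi /g /p /sigma !invX invD -!exprM -exprD.
  by apply: pow2_le; lia.
have g_small : 16 * g <= 1.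
  by apply: le_trans gk; rewrite ler_peMr ?mulr_ge0 ?(ltW (pos _)) // ler1n.
have gam_pow n : (n <= k)%N -> 1 / 2 <= (1 - 2 * g) ^+ n.
  move=> nk; have g0 : 0 < g by apply: pos.
  have g01 : 0 <= 2 * g <= 1 by move: g_small g0; lra.
  apply: le_trans (bernoulli_le n g01).
  have : n%:R * (2 * g) <= k%:R * (2 * g) by apply: ler_wpM2r; [case/andP: g01 | rewrite ler_nat].
  by move: gk; lra.
have [s [us allS bs]] := degenerate_order degH.
have ss : (size s <= k)%N.
  by apply: leq_trans cH; rewrite -(card_uniqP us) max_card.
have eps_p : eps <= p by apply: inv_mono; rewrite /e; lia.
have eps0 : 0 < eps by exact: pos.
have size_bound (x : R) (q : R) u : eps <= q -> q <= 1 -> 0 <= x ->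
    x * (eps ^+ d / 2) <= x * q ^+ back u s * (1 - 2 * g) ^+ size s.
  move=> hq q1 x0; rewrite -mulrA; apply: ler_wpM2l => //.
  have q0 : 0 <= q by exact: le_trans (ltW eps0) hq.
  rewrite -[_ / 2]/(eps ^+ d * 2^-1); apply: ler_pM.
  - by rewrite exprn_ge0 // ltW.
  - by rewrite invr_ge0.
  - apply: le_trans (_ : q ^+ d <= _); first by rewrite lerXn2r ?nnegrE // ltW.
    by apply: ler_wiXn2l.
  - by have := gam_pow _ ss; rewrite div1r.
have eps_d : eps ^+ d = 2 ^- de by rewrite invX mulnC.
have sigmaE : m * (eps ^+ d / 2) = sigma.
  rewrite /m eps_d /sigma !exprD expr1; set X := 2 ^+ T; set Y := 2 ^+ de.
  by field; rewrite gt_eqF //; exact: posX.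
pose red : rel G := fun x y => edge x y && col [set x; y].
have red_sym : symmetric red by move=> x y; rewrite /red edge_sym setUC.
case: (EM (forall U : {set G}, m <= #|U|%:R -> sparse_pair red delta eps U)) => [sp|].
  have big : m * (2 / delta) ^+ h <= #|[set: G]|%:R.
    rewrite cardsT cG natrX TM /m /delta invrK -exprS -exprM [leRHS]exprD.
    by apply: eq_ler; congr (_ * _ ^+ _); rewrite /hx; lia.
  have [W [Wbig Wsp]] := sparse_family red_sym (pos _) (le1 _) (pos _) (posX _) sp big.
  have [|u w uw|f fE] := @sparse_embedding R H G red p Xi g sigma k jum (pos _) (pos _) gk
    k_gt0 pg sigma_big Xi_sparse red_sym s (W \o c) us allS ss.
  - move=> u; have [_ hW] := Wbig _ (c_lt u).
    apply: le_trans (size_bound _ p u eps_p (le1 _) (ler0n _ _)).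
    by rewrite -sigmaE; apply: ler_wpM2r => //; rewrite eps_d divr_ge0 // ltW.
  - have /= h1 := Wsp _ _ (c_lt u) (c_lt w) (c_ok _ _ uw).
    have k2 : 0 <= 2 * k%:R ^+ 2 :> R by rewrite mulr_ge0 // sqr_ge0.
    apply: le_trans (ler_wpM2r k2 h1) _.
    have h2 : 2 ^+ h.+1 * eps * (2 * k%:R ^+ 2) <= g ^+ 2 * p.
      rewrite kE /eps mulrAC -exprM -exprS -exprD ler_pdivrMr // /g /p invX invD.
      by apply: pow2_le; rewrite /e; lia.
    have := ler_wpM2r (ler0n R #|W (c w)|) (ler_wpM2r (ler0n R #|W (c u)|) h2).
    by rewrite -/eps; apply: le_trans; apply: eq_ler; ring.
  apply: (induced_copy (mono := fun x y => edge x y && ~~ red x y) (b := false) _ fE).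
  by move=> x y; rewrite /red => /andP[-> /=]; case: (col _).
move=> nsp; have [U [mU nU]] : exists U : {set G}, m <= #|U|%:R /\ ~ sparse_pair red delta eps U.
  by apply: contrapT => no; apply: nsp => U mU; apply: contrapT => nU; apply: no; exists U.
pose sigmaU : R := #|U|%:R * (eps ^+ d / 2).
have sU : sigma <= sigmaU.
  by rewrite -sigmaE; apply: ler_wpM2r => //; rewrite eps_d divr_ge0 // ltW.
have sigma0 : 0 <= sigma by exact: ltW (posX _).
have tU : 2 * k%:R * (delta * #|U|%:R) <= sigmaU.
  rewrite /sigmaU kE /delta eps_d !exprD; set X := 2 ^+ kap; set Y := 2 ^+ de.
  by apply: eq_ler; field; rewrite !gt_eqF //; exact: posX.
have dense (A B : {set G}) : A \subset U -> B \subset U -> delta * #|U|%:R <= #|A|%:R ->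
    delta * #|U|%:R <= #|B|%:R -> eps * #|A|%:R * #|B|%:R < npairs R red A B.
  by move=> AU BU hA hB; rewrite ltNge; apply/negP => le; apply: nU; exists A, B.
have [|||u|f fE] := @dense_embedding R H G red p Xi g sigmaU eps (delta * #|U|%:R) k U jum
   (pos _) (pos _) g_small pg _ _ (pos _) (le1 _) k_gt0 _ tU red_sym dense s us allS ss.
- by apply: le_trans sigma_big _; apply: ler_wpM2l sU; exact: ltW (pos _).
- apply: le_trans Xi_dense _; apply: ler_wpM2l.
    by apply: mulr_ge0; [apply: exprn_ge0 |]; exact: ltW (pos _).
  by rewrite lerXn2r ?nnegrE // (le_trans sigma0).
- by apply: mulr_ge0 => //; exact: ltW (pos _).
- exact: size_bound (lexx _) (le1 _) (ler0n _ _).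
apply: (induced_copy (mono := red) (b := true) _ fE).
by move=> x y; rewrite /red => /andP[-> ->].
Qed.

(** * The induced Ramsey number *)

(** Every term is at most a multiple of kap d h, and the multiples add up to
    31 + 8 + (12 + 32 + 2 + 6) + (12 + 32) = 135. *)
Lemma host_exponent (kap h d : nat) : (0 < kap)%N -> (0 < h)%N -> (0 < d)%N ->
  (31 + 8 * kap + 2 * (h * (d * (6 * kap + 16) + kap + 3)) + 2 * (d * (6 * kap + 16))
    <= 135 * (kap * d * h))%N.
Proof.
move=> k0 h0 d0.
have h1 : (1 <= kap * d * h)%N by rewrite !muln_gt0 k0 d0.
have h2 : (kap <= kap * d * h)%N by rewrite -mulnA leq_pmulr // muln_gt0 d0.
have h3 : (h <= kap * d * h)%N by rewrite leq_pmull // muln_gt0 k0.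
have h4 : (h * kap <= kap * d * h)%N by rewrite mulnC leq_pmul2r // leq_pmulr.
have h5 : (h * d <= kap * d * h)%N by rewrite mulnC leq_pmul2r // leq_pmull.
have h6 : (d * kap <= kap * d * h)%N by rewrite [(d * _)%N]mulnC leq_pmulr.
have h7 : (d <= kap * d * h)%N by rewrite (leq_trans (leq_pmull d k0)) // leq_pmulr.
have -> : (2 * (h * (d * (6 * kap + 16) + kap + 3)) =
  12 * (kap * d * h) + 32 * (h * d) + 2 * (h * kap) + 6 * h)%N by ring.
have -> : (2 * (d * (6 * kap + 16)) = 12 * (d * kap) + 32 * d)%N by ring.
move: (kap * d * h)%N (h * d)%N (h * kap)%N (d * kap)%N h1 h2 h3 h4 h5 h6 h7 => P a b c.
clear; lia.
Qed.

Lemma chromatic_colorable (H : sgraph) : colorable H (chromatic_number H).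
Proof. by rewrite /chromatic_number; case: ex_minnP. Qed.

Lemma chromatic_le (H : sgraph) q : colorable H q -> (chromatic_number H <= q)%N.
Proof. by rewrite /chromatic_number; case: ex_minnP => n _ h /h. Qed.

Lemma colorable_card (H : sgraph) : colorable H #|H|.
Proof.
apply/existsP; exists [ffun x => enum_rank x].
apply/forallP => x; apply/forallP => y; apply/implyP => exy.
rewrite !ffunE (inj_eq enum_rank_inj); apply: contraTneq exy => ->.
by rewrite edge_irr.
Qed.

Lemma degenerate0_colorable (H : sgraph) : degenerate H 0 -> colorable H 1.
Proof.
move=> dH; apply/existsP; exists [ffun=> ord0].
apply/forallP => x; apply/forallP => y; apply/implyP => xy; exfalso.
pose S := [set x; y]; pose e := [rel u v : H | [&& u \in S, v \in S & edge u v]].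
have subS : is_subgraph S e.
  split=> [u v /=|u v /and3P[-> -> ->] //]; rewrite edge_sym.
  by case: (u \in S); case: (v \in S).
have [|z zS] := dH S e subS; first by apply/set0Pn; exists x; rewrite !inE eqxx.
rewrite leqn0 cards_eq0 => /eqP E.
case/set2P: zS (E) => -> /setP.
  by move/(_ y); rewrite !inE /= !inE !eqxx xy /= orbT.
by move/(_ x); rewrite !inE /= !inE !eqxx edge_sym xy /= orbT.
Qed.

Lemma ramsey_number_exists (H : sgraph) n : has_induced_ramsey_graph H n ->
  exists2 r, is_induced_ramsey_number H r & (r <= n)%N.
Proof.
move=> Hn; have ex : exists m, `[< has_induced_ramsey_graph H m >] by exists n; apply/asboolP.
case: (ex_minnP ex) => r /asboolP Hr min; exists r; last by apply: min; apply/asboolP.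
by split=> // m Hm; apply: min; apply/asboolP.
Qed.

(** Rounding up adds less than 1, and log n >= 1. *)
Lemma up_log_le_log2 (R : realType) (n : nat) : (2 <= n)%N ->
  (up_log 2 n)%:R <= 2 * log2 (n%:R : R).
Proof.
move=> n2; have ln2 : 0 < ln (2 : R) by rewrite ln_gt0 // ltr1n.
have lnle a b : (0 < a)%N -> (a <= b)%N -> ln (a%:R : R) <= ln b%:R.
  by move=> a0 ab; rewrite ler_ln ?ler_nat // posrE ltr0n // (leq_trans a0).
have lb1 : 1 <= log2 (n%:R : R) by rewrite /log2 ler_pdivlMr // mul1r lnle.
have /andP[lb _] := @up_log_bounds 2 n isT n2.
have up0 : (0 < up_log 2 n)%N by rewrite up_log_gt0.
have lb2 : (up_log 2 n).-1%:R <= log2 (n%:R : R).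
  rewrite /log2 ler_pdivlMr // mulr_natl -lnXn // -natrX; apply: lnle (ltnW lb).
  by rewrite expn_gt0.
rewrite -(prednK up0) -natr1; lra.
Qed.

Theorem corollary1p5 (R : realType) :
  exists c : R, forall (H : sgraph) (d k chi : nat),
    degenerate H d -> #|H| = k -> chromatic_number H = chi -> (2 <= chi)%N ->
    exists2 r : nat, is_induced_ramsey_number H r &
      r%:R <= k%:R `^ (c * d%:R * log2 chi%:R).
Proof.
exists 2160 => H d k chi degH cH chiH chi2.
have chik : (chi <= k)%N by rewrite -chiH -cH chromatic_le // colorable_card.
have k2 : (2 <= k)%N := leq_trans chi2 chik.
have d0 : (0 < d)%N.
  rewrite lt0n; apply: contraTneq chi2 => dz; rewrite -ltnNge ltnS -chiH.
  by apply/chromatic_le/degenerate0_colorable; rewrite -dz.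
pose kap := up_log 2 k; pose h := up_log 2 chi.
have kap0 : (0 < kap)%N by rewrite up_log_gt0.
have h0 : (0 < h)%N by rewrite up_log_gt0.
have := chromatic_colorable H; rewrite chiH => /existsP[f /forallP fP].
have host : has_induced_ramsey_graph H (2 ^ (4 * (135 * (kap * d * h)))).
  apply: (@induced_arrow_host R H d kap h _ (fun u => f u : nat) degH).
  - by rewrite cH up_logP.
  - by apply: leqW; apply: leq_up_log.
  - by move=> u; apply: leq_trans (ltn_ord _) (up_logP _ _).
  - by move=> u w uw; have /forallP/(_ w)/implyP/(_ uw) := fP u.
  - exact: host_exponent.
have [r Hr rn] := ramsey_number_exists host; exists r => //.
have k1 : 1 <= k%:R :> R by rewrite ler1n ltnW.
have kap_k : (2 ^ kap <= k ^ 2)%N.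
  have /andP[lb _] := @up_log_bounds 2 k isT k2.
  rewrite -/kap in lb; rewrite -(prednK kap0) expnS -mulnn.
  by apply: leq_mul => //; apply: ltnW.
apply: le_trans (_ : (k ^ (1080 * (d * h)))%N%:R <= _).
  rewrite ler_nat (leq_trans rn) //.
  have -> : (4 * (135 * (kap * d * h)) = kap * (540 * (d * h)))%N by ring.
  have -> : (1080 * (d * h) = 2 * (540 * (d * h)))%N by ring.
  by rewrite [(2 ^ _)%N]expnM [(k ^ _)%N]expnM leq_exp2r // !muln_gt0 d0.
rewrite natrX -powR_mulrn ?ler0n //; apply: ler_powR => //.
have := up_log_le_log2 R chi2; rewrite -/h => hl.
have : d%:R * h%:R <= d%:R * (2 * log2 chi%:R) :> R by apply: ler_wpM2l.
rewrite !natrM; lra.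
Qed.
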